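(* Consider the Private Individual Computation (PIC) protocol with user groups $G_1,\dots,G_m$, server $S$ and corrupted set $\mathcal{C}$. Let $u_{i^*,j^*}$ be an honest (uncorrupted) user, let $C_{i^*}\subset G_{i^*}$ be the set of corrupted users of $G_{i^*}$, and let $n'_{i^*}=|G_{i^*}\setminus C_{i^*}|$. Let $\epsilon>0$, $\delta\in(0,1]$, suppose that all users in $G_{i^*}$ use an identical $\epsilon$-LDP mechanism as the data randomizer $\mathcal{R}_{i^*}$, and that $n'_{i^*}\ge 16e^{\epsilon}\log(2/\delta)$. Set $$\epsilon_c=\log\Bigg(1+\frac{e^\epsilon-1}{e^\epsilon+1}\Big(\sqrt{\frac{64e^{\epsilon}\log(4/\delta)}{n'_{i^*}}}+\frac{8e^\epsilon}{n'_{i^*}}\Big)\Bigg).$$ Then the protocol satisfies $(\epsilon_c,\delta)$-DP for this user, i.e. for all neighboring inputs $X=(X_1,\dots,X_{i^*},\dots,X_m)$ and $X'=(X_1,\dots,X'_{i^*},\dots,X_m)$ that differ only in the data of user $u_{i^*,j^*}$, $$\max\big(D_{\epsilon_c}(\mathcal{A}(X)\,\|\,\mathcal{A}(X')),\ D_{\epsilon_c}(\mathcal{A}(X')\,\|\,\mathcal{A}(X))\big)\le\delta,$$ where $\mathcal{A}(X)$ denotes the output and leakage obtained by the adversary on input $X$.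
   Context: Hockey-stick divergence: for distributions $P,Q$ on a common space $\mathcal{Z}$, $D_{\epsilon}(P\|Q)=\int_{\mathcal{Z}}\max\{0,P(z)-e^{\epsilon}Q(z)\}\,dz$ (applied to random variables via their laws). $\epsilon$-LDP: a randomized mechanism $\mathcal{R}$ on a domain $\mathbb{X}$ is $\epsilon$-LDP if $D_\epsilon(\mathcal{R}(x)\|\mathcal{R}(x'))=0$ for all $x,x'\in\mathbb{X}$. Setting. User $u_{i,j}$ is the $j$-th user of group $G_i$, $n_i=|G_i|$, with data $x_{i,j}$; $X_i=(x_{i,j})_{j\in[n_i]}$. In the PIC protocol every user independently computes $x'_{i,j}\leftarrow\mathcal{R}_i(x_{i,j})$, where $\mathcal{R}_i$ is the randomizer of group $G_i$, and generates a fresh one-time public key $pk_{i,j}$, all keys being i.i.d. and independent of the data. For each group an independent uniformly random permutation $\pi_i$ of $[n_i]$ is drawn; the server obtains the shuffled lists $$L=\big(\{(pk_{1,\pi_1(j)},x'_{1,\pi_1(j)})\}_{j\in[n_1]},\dots,\{(pk_{m,\pi_m(j)},x'_{m,\pi_m(j)})\}_{j\in[n_m]}\big)$$ and computes $f(L)$, for a fixed function $f$, which consists of one output entry $y_{i,k}$ for each entry $(pk_{i,k},x'_{i,k})$ of $L$; user $u_{i,k}$ receives $y_{i,k}$. Adversary. A semi-honest adversary statically corrupts a set $\mathcal{C}\subset G_1\cup\dots\cup G_m\cup\{S\}$. The output and leakage $\mathcal{A}(X)$ it obtains are: if $S\in\mathcal{C}$, the pair $(L,f(L))$ (hence also the outputs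 of the corrupted users), together with, for each group, the partial permutation giving the positions in the shuffled list of the messages of the corrupted users; if $S\notin\mathcal{C}$, the outputs $y_{i,j}$ of the corrupted users $u_{i,j}\in\mathcal{C}$. *)

(* Defs.v *)
From HB Require Import structures.
From mathcomp Require Import all_boot all_order all_algebra all_fingroup.
From mathcomp Require Import all_classical all_reals all_analysis.
From mathcomp Require Import measurable_realfun.

Set Implicit Arguments.
Unset Strict Implicit.
Unset Printing Implicit Defensive.

Import Order.TTheory GRing.Theory Num.Theory.

Local Open Scope classical_set_scope.
Local Open Scope ring_scope.

Definition dprod_display (I : Type) (d : I -> measure_display) :
  measure_display.
Proof. exact: default_measure_display. Qed.

(* Dependent products carry the sigma-algebra generated by the coordinate
   maps; the library only has the non-dependent case of tuples. *)
Definition dprod (I : Type) (d : I -> measure_display)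
    (T : forall i, measurableType (d i)) : Type := forall i, T i.

Section dprod.
Context (I : Type) (d : I -> measure_display)
  (T : forall i, measurableType (d i)).

Definition dprod_cylinders : set (set (dprod T)) :=
  \bigcup_i preimage_set_system setT (fun x : dprod T => x i) measurable.

HB.instance Definition _ := Choice.copy (dprod T) (forall i, T i).
HB.instance Definition _ := isPointed.Build (dprod T) (fun i => point).
HB.instance Definition _ := @isMeasurable.Build (dprod_display d)
  (dprod T) <<s dprod_cylinders >> (@sigma_algebra0 _ setT _)
  (@sigma_algebraC (dprod T) dprod_cylinders)
  (@sigma_algebra_bigcup _ setT _).

Lemma measurable_fun_dprod d' (U : measurableType d') (f : U -> dprod T) :
  (forall i, measurable_fun setT (fun u => f u i)) -> measurable_fun setT f.
Proof.
move=> mf; apply: (@measurability _ _ U (dprod T) setT f dprod_cylinders).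
  by [].
move=> _ [_ [i _ [B mB <-]] <-]; rewrite setTI setTI.
by rewrite -[X in measurable X]setTI; exact: mf.
Qed.

Lemma measurable_dprod_coord i :
  measurable_fun setT (fun x : dprod T => x i).
Proof.
by move=> _ B mB; apply: sub_sigma_algebra; exists i => //; exists B.
Qed.

End dprod.

HB.instance Definition _ (T : finType) := isPointed.Build (perm_type T) 1%g.
HB.instance Definition _ (T : finType) :=
  @isMeasurable.Build default_measure_display
  (perm_type T) discrete_measurable discrete_measurable0
  discrete_measurableC discrete_measurableU.

Definition partial_perm (n : nat) : Type := {ffun 'I_n -> option 'I_n}.
HB.instance Definition _ n := Finite.on (partial_perm n).
HB.instance Definition _ n :=
  isPointed.Build (partial_perm n) [ffun=> None].
HB.instance Definition _ n := @isMeasurable.Build default_measure_display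
  (partial_perm n) discrete_measurable discrete_measurable0
  discrete_measurableC discrete_measurableU.

Lemma measurable_fun_finite_choice d d' (U : measurableType d)
    (V : measurableType d') (F : finType) (S : U -> F) (g : F -> U -> V) :
  (forall s, measurable (S @^-1` [set s])) ->
  (forall s, measurable_fun setT (g s)) ->
  measurable_fun setT (fun u => g (S u) u).
Proof.
move=> mS mg _ B mB; rewrite setTI.
have -> : (fun u => g (S u) u) @^-1` B =
    \bigcup_(s in [set: F]) (S @^-1` [set s] `&` g s @^-1` B).
  apply/seteqP; split=> [u Bu|u [s _ [/= <-]]] //.
  by exists (S u).
apply: fin_bigcup_measurable; first exact: finite_finset.
move=> s _; apply: measurableI; first exact: mS.
by rewrite -[X in measurable X]setTI; exact: mg.
Qed.

Section hockey_stick.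
Context d (Z : measurableType d) (R : realType).
Local Open Scope ereal_scope.
Local Open Scope charge_scope.

Definition law_add (P Q : probability Z R) : set Z -> \bar R :=
  measure_add P Q.

Section law_add.
Variables P Q : probability Z R.

Let law_add0 : law_add P Q set0 = 0. Proof. exact: measure0. Qed.

Let law_add_ge0 A : 0 <= law_add P Q A. Proof. exact: measure_ge0. Qed.

Let law_add_sigma_additive : semi_sigma_additive (law_add P Q).
Proof. exact: measure_semi_sigma_additive. Qed.

HB.instance Definition _ := isMeasure.Build _ _ _ (law_add P Q)
  law_add0 law_add_ge0 law_add_sigma_additive.

Lemma law_addE A : law_add P Q A = P A + Q A.
Proof. exact: measure_addE. Qed.

Let law_add_fin : fin_num_fun (law_add P Q).
Proof.
by move=> A mA; rewrite law_addE fin_numD !fin_num_measure.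
Qed.

HB.instance Definition _ := @Measure_isFinite.Build _ Z R (law_add P Q)
  law_add_fin.

Lemma law_add_dominatesl : P `<< law_add P Q.
Proof.
apply/null_content_dominatesP => A mA; rewrite /= law_addE => /eqP.
by rewrite padde_eq0 ?measure_ge0// => /andP[/eqP].
Qed.

Lemma law_add_dominatesr : Q `<< law_add P Q.
Proof.
apply/null_content_dominatesP => A mA; rewrite /= law_addE => /eqP.
by rewrite padde_eq0 ?measure_ge0// => /andP[_ /eqP].
Qed.

End law_add.

(* The densities of P and Q are taken with respect to P + Q, which dominates
   both; by [hockey_stick_dominated] below, any dominating sigma-finite
   reference measure gives the same value. *)
Definition hockey_stick (eps : R) (P Q : probability Z R) : \bar R :=
  \int[law_add P Q]_z
    maxe 0 (('d (charge_of_finite_measure P) '/d (law_add P Q)) z -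
            (expR eps)%:E *
            ('d (charge_of_finite_measure Q) '/d (law_add P Q)) z).

End hockey_stick.

Section dominated.
Local Open Scope ereal_scope.
Local Open Scope charge_scope.

Lemma hockey_stick_dominated d (Z : measurableType d) (R : realType) (eps : R)
  (P Q : probability Z R) (mu : {sigma_finite_measure set Z -> \bar R}) :
  P `<< mu -> Q `<< mu ->
  hockey_stick eps P Q = \int[mu]_z
    maxe 0 (('d (charge_of_finite_measure P) '/d mu) z -
            (expR eps)%:E * ('d (charge_of_finite_measure Q) '/d mu) z).
Proof.
move=> Pmu Qmu.
have numu : law_add P Q `<< mu.
  apply/null_content_dominatesP => A mA A0; rewrite /= law_addE.
  move/null_content_dominatesP : Pmu => /(_ A mA A0) ->.
  by move/null_content_dominatesP : Qmu => /(_ A mA A0) ->; rewrite adde0.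
have Pnu := @law_add_dominatesl _ _ _ P Q.
have Qnu := @law_add_dominatesr _ _ _ P Q.
rewrite /hockey_stick.
set p := 'd _ '/d _; set q := 'd _ '/d (law_add P Q).
set w := Radon_Nikodym_SigmaFinite.f (law_add P Q) mu.
have mp : measurable_fun setT p.
  apply: (measurable_int (law_add P Q)).
  exact: (@Radon_Nikodym_integrable _ _ _ (charge_of_finite_measure P)).
have mq : measurable_fun setT q.
  apply: (measurable_int (law_add P Q)).
  exact: (@Radon_Nikodym_integrable _ _ _ (charge_of_finite_measure Q)).
have mh : measurable_fun setT (fun z => maxe 0 (p z - (expR eps)%:E * q z)).
  apply: measurable_maxe => //; apply: emeasurable_funB => //.
  exact: measurable_funeM.
rewrite -(Radon_Nikodym_SigmaFinite.change_of_variables numu) //; last 1 first.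
  by move=> x; rewrite le_max lexx.
have chain (S : probability Z R) : S `<< law_add P Q -> S `<< mu -> ae_eq mu setT
   ('d (charge_of_finite_measure S) '/d mu)
   ('d (charge_of_finite_measure S) '/d (law_add P Q) \* w).
  move=> Snu Smu.
  have h1 := @Radon_Nikodym_chain_rule _ _ _
    (charge_of_finite_measure S) mu (law_add P Q) Snu numu.
  apply: (ae_eq_trans h1).
  apply: ae_eqe_mul2l.
  apply: ae_eq_sym; exact: ae_eq_Radon_Nikodym_SigmaFinite.
have w0 := Radon_Nikodym_SigmaFinite.f_ge0 numu.
have wf := Radon_Nikodym_SigmaFinite.f_fin_num numu.
have mw : measurable_fun setT w.
  apply: (measurable_int mu); exact: Radon_Nikodym_SigmaFinite.f_integrable.
apply: ae_eq_integral => //.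
- exact: emeasurable_funM.
- apply: measurable_maxe => //; apply: emeasurable_funB.
    apply: (measurable_int mu).
    exact: (@Radon_Nikodym_integrable _ _ _ (charge_of_finite_measure P)).
  apply/measurable_funeM/(measurable_int mu).
  exact: (@Radon_Nikodym_integrable _ _ _ (charge_of_finite_measure Q)).
have := chain P Pnu Pmu; have := chain Q Qnu Qmu.
apply: filterS2 => z /(_ I) -> /(_ I) -> _ /=.
rewrite -/p -/q -/w muleA -muleBl; last 2 first.
- exact: wf.
- by apply: fin_num_adde_defl; rewrite fin_numN fin_numM //;
  exact: (@Radon_Nikodym_fin_num _ _ _ (charge_of_finite_measure Q)).
by rewrite maxe_pMl ?mul0e //.
Qed.

End dominated.

Definition ldp (R : realType) (eps : R) (D : Type) d (Z : measurableType d)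
    (K : D -> probability Z R) : Prop :=
  forall x x' : D, hockey_stick eps (K x) (K x') = 0%E.

Definition mutually_independent d (Omega : measurableType d) (R : realType)
    (P : probability Omega R) (I : finType) (F : I -> set (set Omega)) : Prop :=
  forall (J : {set I}) (E : I -> set Omega), (forall i, i \in J -> F i (E i)) ->
    P (\bigcap_(i in [set` J]) E i) = (\prod_(i in J) P (E i))%E.

Section parties.
Context (m : nat) (n : 'I_m -> nat).

Definition user : Type := {i : 'I_m & 'I_(n i)}.

Definition mk_user (i : 'I_m) (j : 'I_(n i)) : user := existT _ i j.

Definition party : Type := (user + unit)%type.

HB.instance Definition _ := Finite.on user.
HB.instance Definition _ := Finite.on party.

Definition server : party := inr tt.

Definition group_users (i : 'I_m) : {set user} :=
  [set u : user | tag u == i]%SET.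

Definition corrupted_users (C : {set party}) : {set user} :=
  [set u : user | (inl u : party) \in C]%SET.

(* The entry of the shuffled list of group [i] at position [j] comes from the
   user [s i j] of that group.  List positions of a group are indexed like its
   users, so [user] also serves as the type of positions in the lists. *)
Definition sender (s : forall i, 'S_(n i)) (p : user) : user :=
  mk_user (s (tag p) (tagged p)).

Definition position (s : forall i, 'S_(n i)) (u : user) : user :=
  mk_user ((s (tag u))^-1%g (tagged u)).

Definition corrupted_positions (C : {set party}) (s : forall i, 'S_(n i))
    (i : 'I_m) : partial_perm (n i) :=
  [ffun j => if mk_user j \in corrupted_users C
             then Some (tagged (position s (mk_user j))) else None].

End parties.

Record pic_protocol (R : realType) := PicProtocol {
  num_groups : nat;
  group_size : 'I_num_groups -> nat;
  data : 'I_num_groups -> Type;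
  msg_disp : 'I_num_groups -> measure_display;
  msg : forall i, measurableType (msg_disp i);
  randomizer : forall i, data i -> probability (msg i) R;
  key_disp : measure_display;
  key : measurableType key_disp;
  key_law : probability key R;
  out_disp : 'I_num_groups -> measure_display;
  out : forall i, measurableType (out_disp i);
  server_fun :
    {mfun dprod (fun p : user group_size => (key * msg (tag p))%type) >->
          dprod (fun p : user group_size => out (tag p))}
}.

Arguments group_size {R} Pi i : rename.
Arguments data {R} Pi i : rename.
Arguments msg {R} Pi i : rename.
Arguments randomizer {R} Pi i _ : rename.
Arguments out {R} Pi i : rename.

Section execution.
Context (R : realType) (Pi : pic_protocol R).

Local Notation U := (user (group_size Pi)).
Local Notation party := (party (group_size Pi)).

Definition lists := dprod (fun p : U => (key Pi * msg Pi (tag p))%type).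

Definition outputs := dprod (fun p : U => out Pi (tag p)).

Definition inputs : Type := forall u : U, data Pi (tag u).

Definition preimages d d' (Omega : measurableType d) (T : measurableType d')
  (X : Omega -> T) : set (set Omega) := preimage_set_system setT X measurable.

(* A realization of the random choices of one run on input [X], over an
   arbitrary probability space; the law of the adversary's view is the same
   for all realizations. *)
Record execution (X : inputs) := Execution {
  sample_disp : measure_display;
  sample : measurableType sample_disp;
  prob : probability sample R;
  sent : forall u : U, {RV prob >-> msg Pi (tag u)};
  pk : forall u : U, {RV prob >-> key Pi};
  shuffle : forall i, {RV prob >-> 'S_(group_size Pi i)};
  sent_law : forall u A, measurable A ->
    distribution prob (sent u) A = randomizer Pi (tag u) (X u) A;
  pk_law : forall u A, measurable A ->
    distribution prob (pk u) A = key_law Pi A;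
  shuffle_law : forall i s,
    distribution prob (shuffle i) [set s] =
    (#|{: 'S_(group_size Pi i)}|%:R^-1)%:E;
  sources_independent : mutually_independent prob
    (fun k : U + U + 'I_(num_groups Pi) =>
       match k with
       | inl (inl u) => preimages (sent u)
       | inl (inr u) => preimages (pk u)
       | inr i => preimages (shuffle i)
       end)
}.

(* What the adversary sees depends on whether it corrupts the server
   ([server_view]) or not ([users_view]). *)
Definition server_view :=
  ((lists * outputs) *
   dprod (fun i => partial_perm (group_size Pi i)))%type.

Definition users_view (C : {set party}) :=
  dprod (fun u : {u : U | u \in corrupted_users C} => out Pi (tag (val u))).

Section leakage.
Context (X : inputs) (E : execution X) (C : {set party}).

Definition shuffles (w : sample E) : forall i, 'S_(group_size Pi i) :=
  fun i => shuffle E i w.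

Definition shuffled_lists (w : sample E) : lists :=
  fun p => let u := sender (shuffles w) p in (pk E u w, sent E u w).

Definition user_output (w : sample E) (u : U) : out Pi (tag u) :=
  server_fun Pi (shuffled_lists w) (position (shuffles w) u).

Definition server_leakage (w : sample E) : server_view :=
  ((shuffled_lists w, server_fun Pi (shuffled_lists w)),
   corrupted_positions C (shuffles w)).

Definition users_leakage (w : sample E) : users_view C :=
  fun u => user_output w (val u).

Lemma measurable_shuffle_fiber i s : measurable (shuffle E i @^-1` [set s]).
Proof. by apply: measurable_funPTI. Qed.

Lemma measurable_shuffled_lists : measurable_fun setT shuffled_lists.
Proof.
apply: measurable_fun_dprod => -[i j].
pose g (s : 'S_(group_size Pi i)) (w : sample E) : (key Pi * msg Pi i)%type :=
  (pk E (mk_user (s j)) w, sent E (mk_user (s j)) w).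
apply: (@measurable_fun_finite_choice _ _ _ _ _ (shuffle E i) g) => s.
  exact: measurable_shuffle_fiber.
by apply/measurable_fun_pairP; split; exact: measurable_funPT.
Qed.

Lemma measurable_user_output u :
  measurable_fun setT (fun w => user_output w u).
Proof.
case: u => i j.
pose g (s : 'S_(group_size Pi i)) (w : sample E) : out Pi i :=
  server_fun Pi (shuffled_lists w) (mk_user (s^-1%g j)).
apply: (@measurable_fun_finite_choice _ _ _ _ _ (shuffle E i) g) => s.
  exact: measurable_shuffle_fiber.
pose T (p : U) := out Pi (tag p).
exact: (measurableT_comp (@measurable_dprod_coord _ _ T (mk_user (s^-1%g j)))
  (measurableT_comp (measurable_funPT (server_fun Pi))
                    measurable_shuffled_lists)).
Qed.

Lemma measurable_server_leakage : measurable_fun setT server_leakage.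
Proof.
apply/measurable_fun_pairP; split.
  apply/measurable_fun_pairP; split; first exact: measurable_shuffled_lists.
  exact: measurableT_comp measurable_shuffled_lists.
apply: measurable_fun_dprod => i.
pose g (s : 'S_(group_size Pi i)) (w : sample E) :
    partial_perm (group_size Pi i) :=
  [ffun j => if mk_user j \in corrupted_users C
             then Some (s^-1%g j) else None].
rewrite (_ : (fun w => _) = (fun w => g (shuffle E i w) w)); last by [].
apply: (@measurable_fun_finite_choice _ _ _ _ _ (shuffle E i) g) => s.
  exact: measurable_shuffle_fiber.
exact: measurable_cst.
Qed.

Lemma measurable_users_leakage : measurable_fun setT users_leakage.
Proof. by apply: measurable_fun_dprod => u; exact: measurable_user_output. Qed.

HB.instance Definition _ := isMeasurableFun.Build _ _ _ _ server_leakage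
  measurable_server_leakage.

HB.instance Definition _ := isMeasurableFun.Build _ _ _ _ users_leakage
  measurable_users_leakage.

End leakage.

(* D_eps(A(X) || A(X')).  The laws live on a space that depends on whether the
   server is corrupted. *)
Definition leakage_divergence (C : {set party}) (eps : R) (X X' : inputs)
    (E : execution X) (E' : execution X') : \bar R :=
  if server (group_size Pi) \in C then
    hockey_stick eps (distribution (prob E) (@server_leakage _ E C))
                     (distribution (prob E') (@server_leakage _ E' C))
  else
    hockey_stick eps (distribution (prob E) (@users_leakage _ E C))
                     (distribution (prob E') (@users_leakage _ E' C)).

End execution.

Definition shuffled_eps (R : realType) (eps delta : R) (n : nat) : R :=
  ln (1 + (expR eps - 1) / (expR eps + 1) *
          (Num.sqrt (64 * expR eps * ln (4 / delta) / n%:R) +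
           8 * expR eps / n%:R)).

(* Main.v *)
Require Import Defs.
From HB Require Import structures.
From mathcomp Require Import all_boot all_order all_algebra fingroup perm.
From mathcomp Require Import all_classical all_reals all_analysis.
From mathcomp Require Import measurable_realfun ring lra.

(* The adversary's view is a function of the shuffled lists and of the positions
   of the corrupted users, so it is unchanged when honest users of one group are
   relabelled together with the shuffle.  Hence the probability F(K) of an event
   of the view, as a function of the laws K_j of the messages of the honest
     users
   of the group, is affine in each K_j and symmetric.

   With K0, K1 the two laws of the distinguished user's message, the LDP
     property
   provides probabilities Q0 ~ e^eps K0 - K1 and Q1 ~ e^eps K1 - K0, and L_j
     with
   K_j = e^-eps (Q0 + Q1)/2 + (1 - e^-eps) L_j: with probability e^-eps another
   honest user is a "clone" drawing its message from Q0 or Q1 (Feldman, McMillan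
   and Talwar, "Hiding among the clones").  Given c clones, of which A ~ Bin(c,
     1/2)
   draw from Q0, symmetry only leaves the number of draws from Q0, which is A +
     1
   or A depending on the law of the distinguished user.  The likelihood ratio
   (A + 1) / (c - A) is at most 1 + eta outside an event of probability delta,
     by
   a Chernoff bound on c ~ Bin(n' - 1, e^-eps) and Hoeffding's bound on A.
   Finally K0 and K1 are mixtures of Q0 and Q1 with weights e^eps / (e^eps + 1)
   and 1 / (e^eps + 1), which turns eta into (e^eps - 1) / (e^eps + 1) * eta. *)

Set Implicit Arguments.
Unset Strict Implicit.
Unset Printing Implicit Defensive.

Import Order.TTheory GRing.Theory Num.Theory.
Import numFieldNormedType.Exports.
Local Open Scope classical_set_scope.
Local Open Scope ring_scope.

(** * Multiaffine functions and random subsets *)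

Lemma big_subsetU1 (R : nmodType) (I : finType) (x : I) (S : {set I})
    (phi : {set I} -> R) : x \notin S ->
  \sum_(T : {set I} | T \subset x |: S) phi T =
  \sum_(T : {set I} | T \subset S) phi T +
  \sum_(T : {set I} | T \subset S) phi (x |: T)%SET.
Proof.
move=> xS; rewrite (bigID (fun T : {set I} => x \in T)) /= addrC; congr (_ + _).
  apply: eq_bigl => T; apply/andP/idP => [[TxS xT]|TS].
    by rewrite -(setU1K xS) subsetD1 TxS.
  split; first by rewrite (fintype.subset_trans TS)// finset.subsetUr.
  by apply: contra xS => /(fintype.subsetP TS).
rewrite (reindex_onto (fun T : {set I} => x |: T)%SET
                      (fun T : {set I} => T :\ x)%SET) /=; last first.
  by move=> T /andP[_ xT]; rewrite finset.setD1K.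
apply: eq_bigl => T; rewrite setU11 andbT.
apply/andP/idP => [[xTS /eqP Te]|TS].
  rewrite -(setU1K xS) subsetD1 (fintype.subset_trans _ xTS)
    ?finset.subsetUr//=.
  by rewrite -Te !inE eqxx.
have xT : x \notin T by apply: contra xS => /(fintype.subsetP TS).
by rewrite finset.setUS// setU1K.
Qed.

Section multiaffine.
Context (R : realType) (I : finType) (W : Type).
Variables (mix : R -> W -> W -> W -> Prop).

(* [mix p w1 w2 w] stands for [w = p w1 + (1 - p) w2]. *)
Definition multiaffine (F : (I -> W) -> R) := forall (j : I) p g g1 g2,
  (forall i, i != j -> g1 i = g i) -> (forall i, i != j -> g2 i = g i) ->
  mix p (g1 j) (g2 j) (g j) -> F g = p * F g1 + (1 - p) * F g2.

(* The probability that [T], a subset of [S], is the set of successes of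
   independent trials indexed by [S]. *)
Definition bernoulli_weight (p : R) (S T : {set I}) : R :=
  p ^+ #|T| * (1 - p) ^+ #|(S :\: T)%SET|.

(** One coordinate [x] of [S] is expanded at a time, by induction on [#|S|]; the subsets of [S]
    split according to whether they contain [x]. *)
Lemma multiaffine_expand (F : (I -> W) -> R) p (S : {set I}) g g1 g2 :
  multiaffine F ->
  (forall j, j \in S -> mix p (g1 j) (g2 j) (g j)) ->
  (forall j, j \notin S -> g1 j = g j /\ g2 j = g j) ->
  F g = \sum_(T : {set I} | T \subset S)
    bernoulli_weight p S T * F (fun j => if j \in T then g1 j else g2 j).
Proof.
move=> Faff; move En : #|S| => n.
elim: n S En g g1 g2 => [|n IH] S En g g1 g2 gS gNS.
  have {En} S0 := cards0_eq En; rewrite S0.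
  rewrite (big_pred1 finset.set0) => [|T]; last by rewrite finset.subset0.
  rewrite /bernoulli_weight finset.setD0 !cards0 mulr1 mul1r.
  congr F; apply/funext => j; rewrite inE.
  by have [] := gNS j; rewrite ?S0 ?inE.
have /card_gt0P[x xS] : (0 < #|S|)%N by rewrite En.
have xS' : x \notin (S :\ x)%SET by rewrite !inE eqxx.
have cS' : #|(S :\ x)%SET| = n by move: (cardsD1 x S); rewrite xS En => -[].
pose upd (w : W) (f : I -> W) j := if j == x then w else f j.
have memS' j : j \notin (S :\ x)%SET -> j != x -> j \notin S.
  by rewrite !inE negb_and negbK => /orP[->|].
rewrite (Faff x p g (upd (g1 x) g) (upd (g2 x) g)) /upd; last first.
  by rewrite eqxx; exact: gS.
  by move=> i /negbTE ->.
  by move=> i /negbTE ->.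
rewrite -{1}(finset.setD1K xS) big_subsetU1// addrC.
(* The first summand is the failure of the trial at [x], where [T] avoids [x]; the second is its
   success, with subset [x |: T]. *)
congr (_ + _).
  rewrite (IH _ cS' _ (upd (g2 x) g1) g2).
  - rewrite mulr_sumr; apply: eq_bigr => T TS; rewrite mulrA; congr (_ * F _).
      rewrite /bernoulli_weight mulrCA; congr (_ * _).
      rewrite -exprS; congr (_ ^+ _).
      have xT : x \notin T by apply: contra xS' => /(fintype.subsetP TS).
      by rewrite (cardsD1 x (S :\: T)%SET) !inE xS xT finset.setDDl finset.setUC
        -finset.setDDl.
    apply/funext => j; rewrite /upd; case: ifP => // jT; case: eqP => // jx.
    by move: jT xS'; rewrite jx => /(fintype.subsetP TS) ->.
  - move=> j jS; rewrite /upd; have : j != x by move: jS;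
    rewrite !inE => /andP[].
    by move=> /negbTE ->; apply: gS; move: jS; rewrite !inE => /andP[].
  - move=> j jS; rewrite /upd; case: eqP => [->//|/eqP jx].
    by apply: gNS; exact: memS'.
rewrite (IH _ cS' _ g1 (upd (g1 x) g2)).
- rewrite mulr_sumr; apply: eq_bigr => T TS; rewrite mulrA; congr (_ * F _).
    have xT : x \notin T by apply: contra xS' => /(fintype.subsetP TS).
    rewrite /bernoulli_weight mulrA -exprS cardsU1 xT; congr (_ * _ ^+ _).
    by rewrite finset.setDDl.
  apply/funext => j; rewrite /upd !inE; case: eqP => [->|] //=.
  by case: ifP.
- move=> j jS; rewrite /upd; have : j != x by move: jS; rewrite !inE => /andP[].
  by move=> /negbTE ->; apply: gS; move: jS; rewrite !inE => /andP[].
- move=> j jS; rewrite /upd; case: eqP => [->//|/eqP jx].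
  by apply: gNS; exact: memS'.
Qed.

End multiaffine.

(** * Tail bounds for binomial variables *)

Lemma nonincreasing_le0 (R : realType) (f df : R -> R) :
  (forall x : R, is_derive x 1 f (df x)) -> (forall x, 0 < x -> df x <= 0) ->
  forall x, 0 <= x -> f x <= f 0.
Proof.
move=> fdf df0 x x0.
apply: (@ler0_derive1_nincry R f 0) => // [y|].
  by rewrite in_itv/= andbT => y0; rewrite derive1E derive_val; exact: df0.
apply: derivable_within_continuous => y _.
by have := fdf y => -[].
Qed.

(** By parity take [x] nonnegative. The function exp(-y^2/2) cosh y is nonincreasing there: its
    derivative has the sign of sinh y - y cosh y, which vanishes at 0 and has derivative -y sinh
    y. *)
Lemma cosh_le_expR (R : realType) (x : R) :
  expR x + expR (- x) <= 2 * expR (x ^+ 2 / 2).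
Proof.
wlog x0 : x / 0 <= x => [h|].
  have [/h //|/ltW x0] := leP 0 x.
  by have := h (- x); rewrite opprK sqrrN addrC oppr_ge0; apply.
pose e : R -> R := expR; pose en : R -> R := expR \o -%R.
have dN (y : R) : is_derive y 1 en (- expR (- y)).
  rewrite -mulrN1.
  exact: (is_derive1_comp (is_derive_expR (- y)) (is_deriveNid y 1)).
have dE (y : R) : is_derive y 1 e (expR y) by exact: is_derive_expR.
have sinh_le (y : R) : 0 <= y ->
    expR y - expR (- y) - y * (expR y + expR (- y)) <= 0.
  move=> y0; pose f : R -> R := e - en - id * (e + en).
  have -> : 0 = f 0.
    by rewrite /f /e /en !fctE /= oppr0 subrr mul0r subr0.
  apply: (@nonincreasing_le0 _ f (fun y => - (y * (expR y - expR (- y))))) =>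
    //.
    move=> z; apply: is_derive_eq.
    by rewrite /GRing.scale/= /e /en !fctE /=; ring.
  move=> z z0; rewrite oppr_le0; apply: mulr_ge0; first exact: ltW.
  rewrite subr_ge0 ler_expR; lra.
pose q : R -> R := expR \o (- (2^-1 *: (id ^+ 2))).
have dq (z : R) : is_derive z 1 q (- z * expR (- (2^-1 * z ^+ 2))).
  pose h : R -> R := - (2^-1 *: (id ^+ 2)).
  have dh : is_derive z 1 h (- z).
    by apply: is_derive_eq; rewrite /GRing.scale/=; field.
  rewrite mulrC.
  exact: (is_derive1_comp (is_derive_expR (h z)) dh).
pose g : R -> R := q * (e + en).
have : g x <= g 0.
  apply: (@nonincreasing_le0 _ g (fun y => expR (- (2^-1 * y ^+ 2)) *
     (expR y - expR (- y) - y * (expR y + expR (- y))))) => //.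
    move=> z; apply: is_derive_eq.
    by rewrite /GRing.scale/= /q /e /en !fctE/=; ring.
  by move=> z z0; rewrite mulr_ge0_le0 ?expR_ge0//; apply/sinh_le/ltW.
rewrite /g /q /e /en !fctE/= expr0n/= scaler0 oppr0 expR0 mul1r.
by rewrite [expR (- (_ *: _))]expRN mulrC ler_pdivrMr ?expR_gt0// /GRing.scale/=
  [2^-1 * _]mulrC.
Qed.

Section binomial_tails.
Context (R : realType) (I : finType).
Implicit Types (p z : R) (S T : {set I}).

Lemma bernoulli_weight_ge0 p S T : 0 <= p <= 1 -> 0 <= bernoulli_weight p S T.
Proof.
by move=> /andP[p0 p1]; rewrite mulr_ge0 ?exprn_ge0// subr_ge0.
Qed.

(** A product of coordinates is multiaffine, so expanding each factor [p * z + (1 - p) * 1] over [S]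
    gives the generating function of the binomial law. Both tail bounds take their exponential
    moments from it. *)
Lemma bernoulli_weight_gen p z S :
  \sum_(T : {set I} | T \subset S) bernoulli_weight p S T * z ^+ #|T| =
  (p * z + (1 - p)) ^+ #|S|.
Proof.
pose w : R := p * z + (1 - p).
pose mix (p w1 w2 w : R) := w = p * w1 + (1 - p) * w2.
pose F (g : I -> R) := \prod_i g i.
have Faff : multiaffine mix F.
  move=> j q g g1 g2 g1E g2E gE.
  have FE f : F f = f j * \prod_(i | i != j) f i by rewrite /F (bigD1 j).
  rewrite !FE gE mulrDl.
  rewrite -!mulrA; congr (_ * (_ * _) + _ * (_ * _)).
    by apply: eq_bigr => i ij; rewrite g1E.
  by apply: eq_bigr => i ij; rewrite g2E.
have <- : F (fun j => if j \in S then w else 1) = w ^+ #|S|.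
  by rewrite /F -big_mkcond/= prodr_const.
rewrite (@multiaffine_expand _ _ _ mix F p S _ (fun j => if j \in S then z else
  1)
  (fun=> 1) Faff); last 2 first.
- by move=> j jS; rewrite jS /mix /w mulr1.
- by move=> j /negbTE ->.
apply: eq_bigr => T TS; congr (_ * _); rewrite /F -big_mkcond/=.
rewrite -prodr_const; apply: eq_bigr => j jT.
by rewrite (fintype.subsetP TS).
Qed.

Lemma bernoulli_weight_sum1 p S :
  \sum_(T : {set I} | T \subset S) bernoulli_weight p S T = 1.
Proof.
rewrite -[RHS](expr1n _ #|S|) -[X in X ^+ _](subrKC p 1).
rewrite -[X in X + _]mulr1 -bernoulli_weight_gen.
by apply: eq_bigr => T _; rewrite expr1n mulr1.
Qed.

(** Numerical input for the Chernoff exponent. The lower bound is ln(1 + x) <= x at x = -1/2; the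
    upper one follows from exp(1/8) >= 9/8 and (9/8)^6 >= 2. *)
Lemma ln2_bounds : 1 / 2 <= ln (2 : R) <= 3 / 4.
Proof.
apply/andP; split.
  have := @le_ln1Dx R (- 2^-1); rewrite (_ : 1 + - 2^-1 = 2^-1); last by lra.
  rewrite lnV ?posrE//; lra.
have h : 9 / 8 <= expR (8^-1 : R).
  by apply: le_trans (expR_ge1Dx _); lra.
have -> : 3 / 4 = ln (expR (8^-1 : R) ^+ 6).
  by rewrite -expRM_natl expRK; lra.
rewrite ler_ln ?posrE ?exprn_gt0 ?expR_gt0//.
apply: (@le_trans _ _ ((9 / 8) ^+ 6)); first by rewrite !exprS expr0; lra.
by rewrite lerXn2r ?nnegrE ?expR_ge0//; lra.
Qed.

(** A Chernoff bound in base 2. The threshold is stated with [#|S|.+1] because [S] will be the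
    honest users other than the distinguished one, and the hypothesis on n' counts that user too. *)
Lemma bernoulli_weight_lower_tail p L S : 0 <= p <= 1 -> ln 2 <= L ->
  16 * L <= p * #|S|.+1%:R ->
  \sum_(T : {set I} | (T \subset S) && (#|T|%:R < p * #|S|.+1%:R / 2))
     bernoulli_weight p S T <= expR (- L).
Proof.
move=> p01 L2 pL; have /andP[p0 p1] := p01.
set a := p * #|S|.+1%:R / 2 in pL *.
have la : 0 <= a by rewrite /a !mulr_ge0.
have /andP[l1 l2] := ln2_bounds.
(* Markov's inequality for [2 ^ (a - #|T|)] *)
apply: (@le_trans _ _ (\sum_(T : {set I} | T \subset S)
    bernoulli_weight p S T * 2^-1 ^+ #|T| * expR (a * ln 2))).
  rewrite [leRHS](bigID (fun T : {set I} => #|T|%:R < a))/= -[leLHS]addr0.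
  apply: lerD; last first.
    apply: sumr_ge0 => T _; apply: mulr_ge0 (expR_ge0 _).
    by rewrite mulr_ge0 ?exprn_ge0 ?invr_ge0 ?bernoulli_weight_ge0.
  apply: ler_sum => T /andP[_ Ta];
    rewrite -mulrA ler_peMr ?bernoulli_weight_ge0//.
  rewrite -[2^-1](@lnK R) ?posrE ?invr_gt0// lnV ?posrE//.
  rewrite -expRM_natl -expRD -[leLHS]expR0 ler_expR.
  have -> : #|T|%:R * - ln 2 + a * ln 2 = (a - #|T|%:R) * ln (2:R) by ring.
  apply: mulr_ge0; lra.
rewrite -mulr_suml bernoulli_weight_gen.
have -> : p * 2^-1 + (1 - p) = 1 + - (p / 2) by lra.
apply: (@le_trans _ _ (expR (- (p / 2)) ^+ #|S| * expR (a * ln 2))).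
  apply: ler_wpM2r; first exact: expR_ge0.
  by rewrite lerXn2r ?nnegrE ?expR_ge0 ?expR_ge1Dx//; lra.
rewrite -expRM_natl -expRD ler_expR.
have -> : #|S|%:R = #|S|.+1%:R - 1 :> R by rewrite -natr1 addrK.
(* With b = p (|S| + 1) the exponent is b/2 ln 2 - b/2 + p/2 <= -b/8 + 1/2, by ln 2 <= 3/4; then b
   >= 16 L and L >= 1/2 bring it below -L. *)
rewrite /a in pL la *; nra.
Qed.

Lemma fair_bernoulli_upper_tail S (t : R) : (0 < #|S|)%N -> 0 <= t ->
  \sum_(T : {set I} | (T \subset S) && (#|S|%:R / 2 + t <= #|T|%:R))
     bernoulli_weight 2^-1 S T <= expR (- (2 * t ^+ 2 / #|S|%:R)).
Proof.
move=> S0 t0; set c : R := #|S|%:R.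
have c0 : 0 < c by rewrite ltr0n.
have p01 : 0 <= (2^-1 : R) <= 1 by lra.
(* This [th] minimizes the exponent c th^2 / 8 - th t of Hoeffding's bound, with minimum -2 t^2 /
   c. *)
pose th := 4 * t / c.
have th0 : 0 <= th by rewrite /th divr_ge0 ?mulr_ge0// ltW.
apply: (@le_trans _ _ (\sum_(T : {set I} | T \subset S)
    bernoulli_weight 2^-1 S T * expR th ^+ #|T| * expR (- (th * (c / 2 + t))))).
  rewrite [leRHS](bigID (fun T : {set I} => c / 2 + t <= #|T|%:R))/=
    -[leLHS]addr0.
  apply: lerD; last first.
    apply: sumr_ge0 => T _; apply: mulr_ge0 (expR_ge0 _).
    by rewrite mulr_ge0 ?exprn_ge0 ?expR_ge0 ?bernoulli_weight_ge0.
  apply: ler_sum => T /andP[_ Ta];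
    rewrite -mulrA ler_peMr ?bernoulli_weight_ge0//.
  rewrite -expRM_natl -expRD -[leLHS]expR0 ler_expR [_ * th]mulrC -mulrBr.
  by rewrite mulr_ge0// subr_ge0.
rewrite -mulr_suml bernoulli_weight_gen.
(* Centering each trial turns its moment generating function into a hyperbolic cosine at
   [th / 2]. *)
have -> : 2^-1 * expR th + (1 - 2^-1) =
    expR (th / 2) * ((expR (th / 2) + expR (- (th / 2))) / 2).
  rewrite {1}(_ : th = th / 2 + th / 2); last by lra.
  by rewrite mulrA mulrDr -!expRD subrr expR0; lra.
apply: (@le_trans _ _ ((expR (th / 2) * expR ((th / 2) ^+ 2 / 2)) ^+ #|S| *
    expR (- (th * (c / 2 + t))))).
  apply: ler_wpM2r; first exact: expR_ge0.
  rewrite lerXn2r ?nnegrE ?mulr_ge0 ?expR_ge0 ?divr_ge0 ?addr_ge0 ?expR_ge0//.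
  rewrite ler_wpM2l ?expR_ge0// ler_pdivrMr// [leRHS]mulrC.
  exact: cosh_le_expR.
rewrite -expRD -expRM_natl -expRD ler_expR -/c /th.
rewrite le_eqVlt; apply/orP; left; apply/eqP; field.
by rewrite gt_eqF.
Qed.

End binomial_tails.

(* Double counting of the pairs [(V, x |: V)]: each [phi0 V] is the average of
   [phi1 (x |: V)] over [x \in S :\: V]. *)
Lemma fair_bernoulli_shift (R : realType) (I : finType) (S : {set I}) (phi0 phi1
  : {set I} -> R) (r : R) :
  0 <= r -> (forall V, phi0 V <= 1) -> (forall V, 0 <= phi1 V) ->
  (forall (V : {set I}) x, V \subset S -> x \in (S :\: V)%SET ->
     phi1 (x |: V)%SET = phi0 V) ->
  \sum_(V : {set I} | V \subset S) bernoulli_weight 2^-1 S V * phi0 V <=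
  r * (\sum_(V : {set I} | V \subset S) bernoulli_weight 2^-1 S V * phi1 V) +
  \sum_(V : {set I} | (V \subset S) &&
      (r * (#|S|%:R - #|V|%:R) < #|V|.+1%:R)) bernoulli_weight 2^-1 S V.
Proof.
move=> r0 phi0_le1 phi1_ge0 phi10; set c : R := #|S|%:R.
have p01 : 0 <= (2^-1 : R) <= 1 by lra.
rewrite (bigID (fun V : {set I} => r * (c - #|V|%:R) < #|V|.+1%:R))/= addrC.
apply: lerD; last first.
  by apply: ler_sum => V _; rewrite ler_piMr ?bernoulli_weight_ge0.
(* Under fair trials all subsets of [S] have the same weight, so only counting remains. *)
pose k : R := 2^-1 ^+ #|S|.
have wE (V : {set I}) : V \subset S -> bernoulli_weight 2^-1 S V = k.
  move=> VS; rewrite /bernoulli_weight (_ : 1 - 2^-1 = 2^-1); last by lra.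
  by rewrite -exprD cardsD (finset.setIidPr VS) subnKC ?subset_leq_card.
under eq_bigr => V /andP[VS _] do rewrite wE//.
rewrite -mulr_sumr.
under [in leRHS]eq_bigr => V VS do rewrite wE//.
rewrite -mulr_sumr mulrCA ler_pM2l ?exprn_gt0 ?invr_gt0//.
pose good (n : R) := n + 1 <= r * (c - n).
have goodE (V : {set I}) : ~~ (r * (c - #|V|%:R) < #|V|.+1%:R) = good #|V|%:R.
  by rewrite -leNgt /good natr1.
(* For [x] outside [V] the denominator of [psi (x |: V)] is [c - #|V|], the number of choices of
   [x]. *)
pose psi (V : {set I}) := phi1 V / (c - #|V|%:R + 1).
have leS (V : {set I}) : V \subset S -> #|V|%:R <= c.
  by move=> VS; rewrite ler_nat subset_leq_card.
have phi0E (V : {set I}) : V \subset S -> good #|V|%:R ->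
    phi0 V = \sum_(x in S | x \notin V) psi (x |: V)%SET.
  move=> VS gV; rewrite (eq_bigr (fun=> phi0 V / (c - #|V|%:R))); last first.
    move=> x /andP[xS xV]; rewrite /psi phi10 ?inE ?xV// cardsU1 xV add1n
      -natr1.
    by congr (_ / _); ring.
  rewrite (eq_bigl (fun x => x \in (S :\: V)%SET)); last by move=> x;
    rewrite inE andbC.
  rewrite sumr_const -[RHS]mulr_natr cardsD (finset.setIidPr VS) natrB
    ?subset_leq_card//.
  (* The average is over a nonempty set: for [V] of full size, [good] would read [#|V| + 1 <= 0]. *)
  rewrite divfK// gt_eqF// lt_neqAle subr_ge0 leS// andbT eq_sym.
  apply/negP => /eqP h0; move: gV; rewrite /good h0 mulr0.
  by rewrite leNgt ltr_wpDl.
rewrite (eq_bigr (fun V : {set I} => \sum_(x in S | x \notin V) psi (x |: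
  V)%SET)); last first.
  by move=> V /andP[VS]; rewrite goodE => gV; rewrite phi0E.
rewrite (exchange_big_dep (mem S))/=; last by move=> V x _ /andP[].
rewrite (eq_bigr (fun x => \sum_(V : {set I} |
    (V \subset S) && ((x \in V) && good (#|V|%:R - 1))) psi V)); last first.
  move=> x xS; rewrite (reindex_onto (fun V : {set I} => V :\ x)%SET
                                     (fun V : {set I} => x |: V)%SET)/=;
                                       last first.
    by move=> V /andP[_ /andP[_ xV]]; rewrite setU1K.
  have xVE (V : {set I}) : ((x |: V :\ x)%SET == V) = (x \in V).
    apply/eqP/idP => [<-|]; first by rewrite !inE eqxx.
    exact: finset.setD1K.
  apply: eq_big => V; last by rewrite xVE => /andP[_ xV]; rewrite finset.setD1K.
  rewrite xVE goodE xS !inE eqxx/= andbT [RHS]andbCA andbC.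
  case: (boolP (x \in V)) => //= xV; congr (_ && _).
    by rewrite -{2}(finset.setD1K xV) finset.subUset finset.sub1set xS.
  by rewrite (cardsD1 x V) xV natrD addrAC subrr add0r.
rewrite (exchange_big_dep (fun V : {set I} => V \subset S))/=; last first.
  by move=> x V _ /andP[].
rewrite mulr_sumr; apply: ler_sum => V VS.
(* Each [V] is now reached from its [#|V|] elements, and [good (#|V| - 1)] reads
   [#|V| <= r * (c - #|V| + 1)], which cancels the denominator of [psi V]. *)
have [gV|gV] := boolP (good (#|V|%:R - 1)); last first.
  by rewrite big1 ?mulr_ge0// => x /andP[_ /andP[_ /andP[]]];
    rewrite ?(negbTE gV).
rewrite (eq_bigl (fun x => x \in V)); last first.
  move=> x; rewrite VS andbT/=.
  by case: (boolP (x \in V)) => xV;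
    rewrite ?andbT ?andbF// (fintype.subsetP VS).
rewrite sumr_const -[leLHS]mulr_natr /psi mulrAC ler_pdivrMr; last first.
  by have := leS V VS; lra.
rewrite [leRHS]mulrAC mulrC; apply: ler_wpM2r => //.
by move: gV; rewrite /good; lra.
Qed.

(** The goal amounts to 2k - c + 1 <= eta (c - k). With t = sqrt(c L / 2), 2k - c < 2t; moreover L
    <= c/8 gives t <= c/4, hence c - k >= c/4. In eta c/4 the square root then pays for 2t and the
    term 8/b for 1; this is where the constants 64 and 8 come from. *)
Lemma likelihood_ratio_le (R : realType) (b c k L eta : R) :
  0 < L -> 16 * L <= b -> b / 2 <= c ->
  Num.sqrt (64 * L / b) + 8 / b <= eta -> k < c / 2 + Num.sqrt (c * L / 2) ->
  k + 1 <= (1 + eta) * (c - k).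
Proof.
move=> L0 Lb bc; set s := Num.sqrt (64 * L / b); set t := Num.sqrt (c * L / 2).
move=> hs kt.
have b0 : 0 < b by lra.
have c0 : 0 < c by lra.
have t0 : 0 <= t by exact: sqrtr_ge0.
have s0 : 0 <= s by exact: sqrtr_ge0.
have t2 : t ^+ 2 = c * L / 2 by rewrite sqr_sqrtr// !mulr_ge0//; lra.
have s2 : s ^+ 2 = 64 * L / b by rewrite sqr_sqrtr// divr_ge0//; lra.
have tc : t <= c / 4.
  have tcE : t ^+ 2 <= (c / 4) ^+ 2 by rewrite t2; nra.
  by move: tcE; rewrite ler_pXn2r ?nnegrE//; lra.
have sc : 8 * t <= s * c.
  have scE : (8 * t) ^+ 2 <= (s * c) ^+ 2.
    rewrite !exprMn t2 s2.
    have -> : 64 * L / b * c ^+ 2 = 64 * L * c * (c / b) by field; lra.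
    have h : 1 / 2 <= c / b by rewrite ler_pdivlMr//; lra.
    apply: (@le_trans _ _ (64 * L * c * (1 / 2))); first by lra.
    by apply: ler_wpM2l => //; rewrite !mulr_ge0//; lra.
  by move: scE; rewrite ler_pXn2r ?nnegrE ?mulr_ge0//; lra.
have cb : 2 <= 8 / b * (c / 2).
  have -> : 8 / b * (c / 2) = 4 * c / b by field; lra.
  by rewrite ler_pdivlMr//; lra.
have : (s + 8 / b) * (c / 4) <= eta * (c - k).
  by apply: ler_pM => //; [rewrite addr_ge0 ?divr_ge0//; lra|lra|lra].
lra.
Qed.

(** * The clone argument for symmetric multiaffine functions *)

Section clones.
Context (R : realType) (I : finType).

(** Two failures, each of probability at most exp(-L): fewer than half the nominal number
    [p * #|O|.+1] of clones, or, given enough clones, too many of them drawing from the first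
    law. *)
Lemma bad_clones_le (O : {set I}) (p L eta : R) :
  0 <= p <= 1 -> ln 2 <= L -> 16 * L <= p * #|O|.+1%:R ->
  Num.sqrt (64 * L / (p * #|O|.+1%:R)) + 8 / (p * #|O|.+1%:R) <= eta ->
  \sum_(T : {set I} | T \subset O) bernoulli_weight p O T *
    (\sum_(V : {set I} | (V \subset T) &&
       ((1 + eta) * (#|T|%:R - #|V|%:R) < #|V|.+1%:R))
       bernoulli_weight 2^-1 T V) <= 2 * expR (- L).
Proof.
move=> p01 L2 Lb; set b : R := p * #|O|.+1%:R in Lb * => heta.
have half01 : 0 <= (2^-1 : R) <= 1 by lra.
have L0 : 0 < L by apply: lt_le_trans L2; rewrite ln_gt0//; lra.
have sub1 (S : {set I}) (P : pred {set I}) (q : R) : 0 <= q <= 1 ->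
    \sum_(T : {set I} | (T \subset S) && P T) bernoulli_weight q S T <= 1.
  move=> q01; rewrite -(bernoulli_weight_sum1 q S).
  rewrite [leRHS](bigID P)/= lerDl; apply: sumr_ge0 => T _.
  exact: bernoulli_weight_ge0.
rewrite (bigID (fun T : {set I} => #|T|%:R < b / 2))/=.
rewrite mulr_natl mulr2n.
apply: lerD.
  apply: le_trans (bernoulli_weight_lower_tail p01 L2 Lb).
  by apply: ler_sum => T _; rewrite ler_piMr ?bernoulli_weight_ge0 ?sub1.
apply: (@le_trans _ _ (\sum_(T : {set I} | (T \subset O) && ~~ (#|T|%:R < b /
  2))
    bernoulli_weight p O T * expR (- L))); last first.
  by rewrite -mulr_suml ler_piMl ?expR_ge0 ?sub1.
apply: ler_sum => T /andP[_]; rewrite -leNgt => bT.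
apply: ler_wpM2l; first exact: bernoulli_weight_ge0.
set c : R := #|T|%:R in bT *.
have b0 : 0 < b / 2 by rewrite divr_gt0//; apply: lt_le_trans Lb;
  rewrite mulr_gt0.
have c0 : 0 < c := lt_le_trans b0 bT.
(* This puts [L] in the form of Hoeffding's exponent for the deviation sqrt(c L / 2). *)
have -> : L = 2 * Num.sqrt (c * L / 2) ^+ 2 / c.
  by rewrite sqr_sqrtr ?divr_ge0 ?mulr_ge0 ?ltW//; field; rewrite gt_eqF.
apply: le_trans (@fair_bernoulli_upper_tail R I T (Num.sqrt (c * L / 2)) _ _);
  last 2 first.
- by move: c0; rewrite ltr0n.
- exact: sqrtr_ge0.
rewrite [leRHS](bigID (fun V : {set I} => (1 + eta) * (c - #|V|%:R) <
  #|V|.+1%:R))/=.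
rewrite -[leLHS]addr0; apply: lerD; last first.
  by apply: sumr_ge0 => V _; exact: bernoulli_weight_ge0.
(* By the contrapositive of [likelihood_ratio_le], every bad [V] lies in the upper tail. *)
rewrite le_eqVlt; apply/orP; left; apply/eqP; apply: eq_bigl => V.
rewrite -andbA; congr (_ && _).
have [h|] := boolP (_ < #|V|.+1%:R); last by rewrite andbF.
rewrite andbT; apply/esym; rewrite leNgt; apply: contraTN h => h.
by rewrite -leNgt -natr1; exact: likelihood_ratio_le heta h.
Qed.

Variables (W : Type) (mix : R -> W -> W -> W -> Prop) (F : (I -> W) -> R).
Hypothesis Faff : multiaffine mix F.
Hypothesis F01 : forall g, 0 <= F g <= 1.
Variables (O : {set I}) (u : I).
Hypothesis uO : u \notin O.
Hypothesis Fsym : forall x g, x \in O -> F (g \o tperm x u) = F g.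

Definition set_at (g : I -> W) (w : W) (j : I) := if j == u then w else g j.

(** Two expansions, first into clones and non-clones, then of each clone into [Q0] or [Q1], reduce
    the claim to a fixed clone set [T], where [fair_bernoulli_shift] applies with ratio
    [1 + eta]. *)
Lemma clones_le (p eta : R) (Q0 Q1 H : W) (K L : I -> W) :
  0 <= p <= 1 -> 0 <= eta ->
  mix 2^-1 Q0 Q1 H -> (forall j, j \in O -> mix p H (L j) (K j)) ->
  F (set_at K Q0) <= (1 + eta) * F (set_at K Q1) +
  \sum_(T : {set I} | T \subset O) bernoulli_weight p O T *
    (\sum_(V : {set I} | (V \subset T) &&
       ((1 + eta) * (#|T|%:R - #|V|%:R) < #|V|.+1%:R))
       bernoulli_weight 2^-1 T V).
Proof.
move=> p01 eta0 mixH mixK.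
(* [T] is the set of clones, [V] the clones that draw from [Q0], and [Q] the law of the
   distinguished user [u]. *)
pose conf Q (T V : {set I}) j :=
  if j \in V then Q0 else if j \in T then Q1 else
  if j == u then Q else if j \in O then L j else K j.
have expand Q : F (set_at K Q) = \sum_(T : {set I} | T \subset O)
    bernoulli_weight p O T * \sum_(V : {set I} | V \subset T)
      bernoulli_weight 2^-1 T V * F (conf Q T V).
  rewrite (multiaffine_expand (S := O) (p := p)
    (g1 := fun j => if j \in O then H else set_at K Q j)
    (g2 := fun j => if j \in O then L j else set_at K Q j) Faff); last 2 first.
  - move=> j jO; rewrite jO /set_at; case: eqP => [ju|_]; last exact: mixK.
    by move: uO; rewrite -ju jO.
  - by move=> j /negbTE ->.
  apply: eq_bigr => T TO; congr (_ * _).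
  have jO j : j \in T -> j \in O by move=> /(fintype.subsetP TO).
  rewrite (multiaffine_expand (S := T) (p := 2^-1)
    (g1 := fun j => if j \in T then Q0 else if j \in O then L j else set_at K Q
      j)
    (g2 := fun j => if j \in T then Q1 else if j \in O then L j else set_at K Q
      j)
    Faff); last 2 first.
  - by move=> j jT; rewrite jT (jO _ jT).
  - by move=> j /negbTE ->.
  apply: eq_bigr => V VT; congr (_ * F _); apply/funext => j; rewrite /conf.
  have [jV|jV] := boolP (j \in V); first by rewrite (fintype.subsetP VT).
  case: (boolP (j \in T)) => // jT; rewrite /set_at.
  by case: eqP => // ->; rewrite (negbTE uO).
rewrite !expand mulr_sumr -big_split/=; apply: ler_sum => T TO.
rewrite mulrCA -mulrDr ler_wpM2l ?bernoulli_weight_ge0//.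
apply: fair_bernoulli_shift.
- by rewrite addr_ge0.
- by move=> V; case/andP: (F01 (conf Q0 T V)).
- by move=> V; case/andP: (F01 (conf Q1 T V)).
(* Exchanging [x] and [u] matches [u] drawing from [Q1] and clone [x] from [Q0] with the reverse
   situation. *)
move=> V x VT; rewrite inE => /andP[xV xT].
have xO := fintype.subsetP TO _ xT.
have uT : u \notin T by apply: contra uO => /(fintype.subsetP TO).
have uV : u \notin V by apply: contra uT => /(fintype.subsetP VT).
have xu : x != u by apply: contraNneq uO => <-.
rewrite -(Fsym _ xO); congr F; apply/funext => j; rewrite /conf /=.
case: tpermP => [->|->|/eqP jx /eqP ju].
- by rewrite !inE (negbTE xV) xT eq_sym (negbTE xu) (negbTE uV) (negbTE uT)
  eqxx.
- by rewrite !inE eqxx/= (negbTE uV) (negbTE uT) eqxx.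
- by rewrite !inE (negbTE jx)/= (negbTE ju).
Qed.

(** Let f0, f1 be the values at [Q0], [Q1], and m the value at [K1]. The value at [K0] is m + a (f0
    - f1) with a = (e - 1)/(e + 1). If f1 <= f0 then f1 <= m, so f0 - f1 <= eta f1 + delta gives the
    factor 1 + a eta, which is exp(eps_c); otherwise the difference is nonpositive. *)
Lemma shuffled_mixture_le (eps delta : R) (Q0 Q1 H K0 K1 : W) (K L : I -> W) :
  0 < eps -> 0 < delta <= 1 ->
  16 * expR eps * ln (2 / delta) <= #|O|.+1%:R ->
  mix 2^-1 Q0 Q1 H -> (forall j, j \in O -> mix (expR (- eps)) H (L j) (K j)) ->
  mix (expR eps / (expR eps + 1)) Q0 Q1 K0 ->
  mix (1 / (expR eps + 1)) Q0 Q1 K1 ->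
  F (set_at K K0) <=
    expR (shuffled_eps eps delta #|O|.+1) * F (set_at K K1) + delta.
Proof.
move=> eps0 /andP[d0 d1] hn mixH mixK mix0 mix1.
set e := expR eps in hn mix0 mix1 *.
have e1 : 1 < e by rewrite expR_gt1.
set n : R := #|O|.+1%:R in hn *.
have n0 : 0 < n by rewrite ltr0n.
pose p := expR (- eps).
have p01 : 0 <= p <= 1.
  by rewrite expR_ge0 /= -[leRHS]expR0 ler_expR oppr_le0 ltW.
pose eta := Num.sqrt (64 * e * ln (4 / delta) / n) + 8 * e / n.
have eta0 : 0 <= eta.
  by rewrite addr_ge0 ?sqrtr_ge0// !mulr_ge0 ?invr_ge0 ?(ltW n0)//; lra.
have bE : p * n = n / e by rewrite /p expRN mulrC.
have L2 : ln 2 <= ln (2 / delta).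
  rewrite ler_ln ?posrE ?divr_gt0// ler_pdivlMr//; lra.
have L24 : ln (2 / delta) <= ln (4 / delta).
  by rewrite ler_ln ?posrE ?divr_gt0// ler_wpM2r ?invr_ge0 ?(ltW d0)//; lra.
have Lb : 16 * ln (2 / delta) <= p * n.
  by rewrite bE ler_pdivlMr; lra.
(* The tail bounds run at level ln(2/delta), so that two failures cost [delta]; the larger
   ln(4/delta) in [eta] is absorbed by monotonicity. *)
have etaE : Num.sqrt (64 * ln (2 / delta) / (p * n)) + 8 / (p * n) <= eta.
  rewrite bE invf_div !mulrA; apply: lerD.
    rewrite ler_wsqrtr// ler_wpM2r ?invr_ge0 ?(ltW n0)//.
    by rewrite mulrAC ler_wpM2l ?mulr_ge0//; lra.
  by [].
have h := clones_le p01 eta0 mixH mixK.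
have {}h := le_trans h (lerD (lexx _) (bad_clones_le p01 L2 Lb etaE)).
have dE : 2 * expR (- ln (2 / delta)) = delta.
  by rewrite expRN lnK ?posrE ?divr_gt0//; field; rewrite gt_eqF.
rewrite dE in h.
have mixF q Q : mix q Q0 Q1 Q ->
    F (set_at K Q) = q * F (set_at K Q0) + (1 - q) * F (set_at K Q1).
  move=> mQ; apply: (Faff (j := u)); rewrite /set_at ?eqxx//.
    by move=> i /negbTE ->.
  by move=> i /negbTE ->.
rewrite (mixF _ _ mix0) (mixF _ _ mix1) /shuffled_eps -/e -/n -/eta.
have /andP[F00 _] := F01 (set_at K Q0).
have /andP[F10 _] := F01 (set_at K Q1).
rewrite lnK ?posrE; last first.
  by rewrite ltr_pwDl// mulr_ge0// divr_ge0//; lra.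
move: h F00 F10; set f0 := F _; set f1 := F _ => h F00 F10.
have ep : e + 1 != 0 by rewrite gt_eqF//; lra.
have -> : 1 - e / (e + 1) = 1 / (e + 1) by field.
have -> : 1 - 1 / (e + 1) = e / (e + 1) by field.
pose a := (e - 1) / (e + 1).
have a01 : 0 <= a <= 1.
  by rewrite /a divr_ge0/= ?ler_pdivrMr; lra.
pose m := 1 / (e + 1) * f0 + e / (e + 1) * f1.
have mE : e / (e + 1) * f0 + 1 / (e + 1) * f1 = m + a * (f0 - f1).
  by rewrite /m /a; field.
rewrite mE -/m -/a [leRHS](_ : _ = m + (a * (eta * m) + delta)); last by ring.
rewrite lerD2l.
have /andP[a0 a1] := a01.
have m_ge : f1 <= f0 -> f1 <= m.
  move=> f10; have -> : m = f1 + (f0 - f1) / (e + 1) by rewrite /m; field.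
  by rewrite lerDl divr_ge0 ?subr_ge0//; lra.
have m0 : 0 <= m by rewrite addr_ge0// mulr_ge0// divr_ge0//; lra.
have [f10|/ltW f01] := leP f1 f0.
  apply: (@le_trans _ _ (a * (eta * m + delta))).
    apply: ler_wpM2l => //.
    have : eta * f1 <= eta * m by apply: ler_wpM2l => //; exact: m_ge.
    lra.
  by rewrite mulrDr lerD2l ler_piMl ?(ltW d0).
apply: (@le_trans _ _ 0); first by rewrite mulr_ge0_le0// subr_le0.
by apply: addr_ge0 (ltW d0); do 2 apply: mulr_ge0 => //.
Qed.

End clones.

(** * Hockey-stick divergence *)

Section hockey_stick_theory.
Local Open Scope ereal_scope.
Local Open Scope charge_scope.
Context d (Z : measurableType d) (R : realType).
Variables (eps : R) (P Q : probability Z R).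

Let mu : {finite_measure set Z -> \bar R} := law_add P Q.
Let p : Z -> \bar R := 'd (charge_of_finite_measure P) '/d mu.
Let q : Z -> \bar R := 'd (charge_of_finite_measure Q) '/d mu.
Let h (z : Z) : \bar R := p z - (expR eps)%:E * q z.

Let p_int : mu.-integrable setT p.
Proof.
by apply: (@Radon_Nikodym_integrable _ _ _ (charge_of_finite_measure P));
  exact: law_add_dominatesl.
Qed.

Let q_int : mu.-integrable setT q.
Proof.
by apply: (@Radon_Nikodym_integrable _ _ _ (charge_of_finite_measure Q));
  exact: law_add_dominatesr.
Qed.

Let h_int : mu.-integrable setT h.
Proof. by apply: integrableB => //; exact: integrableZl. Qed.

Let integral_h A : measurable A ->
  \int[mu]_(z in A) h z = P A - (expR eps)%:E * Q A.
Proof.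
move=> mA.
have pA : mu.-integrable A p by exact: integrableS p_int.
have qA : mu.-integrable A q by exact: integrableS q_int.
rewrite integralB//; last exact: integrableZl.
rewrite integralZl//.
rewrite /p -(@Radon_Nikodym_integral _ _ _ (charge_of_finite_measure P))//;
  last exact: law_add_dominatesl.
rewrite /q -(@Radon_Nikodym_integral _ _ _ (charge_of_finite_measure Q))//.
exact: law_add_dominatesr.
Qed.

(** The positive part of the density difference dominates the difference on [A] and is nonnegative
    off [A]. This turns LDP into inequalities between events. *)
Lemma hockey_stick_ge A : measurable A ->
  P A - (expR eps)%:E * Q A <= hockey_stick eps P Q.
Proof.
move=> mA; rewrite -integral_h//.
have mh : measurable_fun setT (fun z => maxe 0 (h z)).
  by apply: measurable_maxe => //; exact: measurable_int h_int.
apply: (@le_trans _ _ (\int[mu]_(z in A) maxe 0 (h z))); last first.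
  apply: ge0_subset_integral => //.
  by move=> z _; rewrite le_max lexx.
apply: le_integral => //.
- exact: integrableS h_int.
- apply: (integrableS measurableT) => //.
  have -> : (fun z => maxe 0 (h z)) = h^\+.
    by apply/funext => z; rewrite funeposE maxC.
  exact: integrable_funepos.
- by move=> z _; rewrite le_max lexx orbT.
Qed.

(** The divergence is attained at the event where the density difference is nonnegative, so a bound
    on all events suffices. *)
Lemma hockey_stick_le (delta : R) :
  (forall A, measurable A -> P A <= (expR eps)%:E * Q A + delta%:E) ->
  hockey_stick eps P Q <= delta%:E.
Proof.
move=> PQ.
have mh : measurable_fun setT h by exact: measurable_int h_int.
pose A := [set z | 0 <= h z].
have mA : measurable A.
  rewrite -[X in measurable X]setTI; exact: emeasurable_fun_c_infty.
have -> : hockey_stick eps P Q = \int[mu]_(z in A) h z.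
  rewrite [RHS]integral_mkcond; apply: eq_integral => z _.
  rewrite patchE -/p -/q; case: ifPn.
    by rewrite inE => hz; apply/max_idPr.
  by rewrite notin_setE => /negP; rewrite -ltNge => /ltW hz; apply/max_idPl.
rewrite integral_h// leeBlDl//; last first.
  by rewrite fin_numM// fin_num_measure.
exact: PQ.
Qed.

End hockey_stick_theory.

(** * Laws of independent families *)

Definition pr d (T : measurableType d) (R : realType) (P : probability T R)
  (A : set T) : R := fine (P A).

Lemma prE d (T : measurableType d) (R : realType) (P : probability T R) A :
  measurable A -> P A = (pr P A)%:E.
Proof. by move=> mA; rewrite /pr fineK// fin_num_measure. Qed.

Lemma pr_ge0_le1 d (T : measurableType d) (R : realType) (P : probability T R) A
  :
  measurable A -> 0 <= pr P A <= 1.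
Proof.
by move=> mA; rewrite -!lee_fin -prE// measure_ge0 probability_le1.
Qed.

(* [a] may lie outside [0, 1]. *)
Section affine_law.
Context d (T : measurableType d) (R : realType) (P Q : probability T R) (a : R).

(** [crestr0] makes the charge vanish on non-measurable sets: [measure_of_charge] asks for
    nonnegativity on every set, whereas [affine_ge0] speaks of measurable ones. *)
Let affine_charge : {charge set T -> \bar R} :=
  crestr0 (cadd (cscale a (charge_of_finite_measure P))
                (cscale (1 - a) (charge_of_finite_measure Q))) measurableT.

Let affine_chargeE A : measurable A ->
  affine_charge A = (a * pr P A + (1 - a) * pr Q A)%:E.
Proof.
move=> mA; rewrite /affine_charge /= /crestr0 mem_set// /crestr setIT.
rewrite -[LHS]/(a%:E * P A + (1 - a)%:E * Q A)%E.
by rewrite !prE.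
Qed.

Hypothesis affine_ge0 : forall A, measurable A -> 0 <= a * pr P A + (1 - a) * pr
  Q A.

Let affine_charge_ge0 A : (0 <= affine_charge A)%E.
Proof.
have [mA|mA] := pselect (measurable A).
  by rewrite affine_chargeE// lee_fin affine_ge0.
by rewrite /affine_charge /= /crestr0 memNset.
Qed.

Definition affine_law := measure_of_charge affine_charge affine_charge_ge0.

HB.instance Definition _ := Measure.on affine_law.

Let affine_lawT : affine_law setT = 1%E.
Proof.
rewrite /affine_law /measure_of_charge affine_chargeE//.
by rewrite /pr !probability_setT/= !mulr1 subrKC.
Qed.

HB.instance Definition _ := Measure_isProbability.Build _ _ _ affine_law
  affine_lawT.

(** With [a] above 1 this extrapolates past [P], away from [Q]; the laws [Q0], [Q1] and [L j] arise
    this way, with nonnegativity supplied by LDP. *)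
Lemma affine_law_ex : exists L : probability T R,
  forall A, measurable A -> pr L A = a * pr P A + (1 - a) * pr Q A.
Proof.
exists affine_law => A mA.
exact: (congr1 fine (affine_chargeE mA)).
Qed.

End affine_law.

(** A relation tested on measurable sets, since the measure axioms do not determine the values of a
    [probability] elsewhere. *)
Definition mixture d (T : measurableType d) (R : realType) (p : R)
    (Q0 Q1 Q : probability T R) : Prop :=
  0 <= p <= 1 /\
  forall A, measurable A -> pr Q A = p * pr Q0 A + (1 - p) * pr Q1 A.

Section product_law.
Context (R : realType) (I : finType) (d : I -> measure_display)
  (T : forall i, measurableType (d i)).
Implicit Types (nu : forall i, probability (T i) R)
  (M : {measure set (dprod T) -> \bar R}).

Definition rectangle (B : forall i, set (T i)) : set (dprod T) :=
  [set x | forall i, B i (x i)].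

Lemma measurable_rectangle B : (forall i, measurable (B i)) ->
  measurable (rectangle B).
Proof.
move=> mB; rewrite (_ : rectangle B =
    \bigcap_(i in [set: I]) ((fun x : dprod T => x i) @^-1` B i)).
  apply: fin_bigcap_measurable; first exact: finite_finset.
  move=> i _; rewrite -[X in measurable X]setTI.
  exact: measurable_dprod_coord.
by apply/seteqP; split=> [x xB i _|x xB i]; exact: xB.
Qed.

Definition product_law nu M := forall B, (forall i, measurable (B i)) ->
  M (rectangle B) = (\prod_i pr (nu i) (B i))%:E.

(** Rectangles are stable under intersection and generate the sigma-algebra, since a cylinder is a
    rectangle with [setT] on the other sides. *)
Lemma product_law_unique nu M M' : product_law nu M -> product_law nu M' ->
  forall A, measurable A -> M A = M' A.
Proof.
move=> nuM nuM' A mA.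
pose G : set (set (dprod T)) :=
  [set X | exists2 B, (forall i, measurable (B i)) & X = rectangle B].
have setT_rect : [set: dprod T] = rectangle (fun=> setT).
  by apply/seteqP; split.
apply: (@measure_unique _ R (dprod T) G (fun=> setT)) => //.
- apply/seteqP; split.
    apply: smallest_sub; first exact: smallest_sigma_algebra.
    move=> _ [i _ [B mB <-]]; apply: sub_sigma_algebra.
    exists (dfwith (fun i => [set: T i]) i B) => [j|].
      by case: dfwithP.
    apply/seteqP; split=> [x [_ xB] j|x xB].
      by case: dfwithP.
    by split=> //; have := xB i; rewrite dfwithin.
  apply: smallest_sub; first exact: sigma_algebra_measurable.
  by move=> _ [B mB ->]; exact: measurable_rectangle.
- move=> _ _ [B mB ->] [B' mB' ->]; exists (fun i => B i `&` B' i).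
    by move=> i; exact: measurableI.
  apply/seteqP; split=> [x [xB xB'] i|x xB]; first by split.
  by split=> i; have [] := xB i.
- by move=> _; exists (fun=> setT).
- by rewrite bigcup_const//; exists 0%N.
- by move=> _ [B mB ->]; rewrite nuM// nuM'.
- by move=> _ /=; rewrite setT_rect nuM// ltry.
Qed.

Definition dprod_replace (k : I) (xt : dprod T * T k) : dprod T :=
  dfwith xt.1 k xt.2.

Lemma measurable_dprod_replace k : measurable_fun setT (@dprod_replace k).
Proof.
apply: measurable_fun_dprod => i; rewrite /dprod_replace.
have [<-|ki] := eqVneq k i.
  by under eq_fun do rewrite dfwithin; exact: measurable_snd.
under eq_fun do rewrite dfwithout//.
apply: (measurableT_comp (@measurable_dprod_coord _ _ T i)).
exact: measurable_fst.
Qed.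

HB.instance Definition _ k := isMeasurableFun.Build _ _ _ _ (@dprod_replace k)
  (@measurable_dprod_replace k).

Lemma product_law_replace nu k (M : probability (dprod T) R) (Q : probability (T
  k) R) :
  product_law nu M ->
  product_law (dfwith nu k Q) (distribution (M \x Q)%E (@dprod_replace k)).
Proof.
move=> nuM B mB; rewrite /= /distribution /pushforward.
have -> : @dprod_replace k @^-1` rectangle B =
    rectangle (dfwith B k setT) `*` B k.
  apply/seteqP; split=> [[x t] /= xB|[x t] [/= xB tB] i].
    split=> [i|]; last by have := xB k; rewrite /dprod_replace dfwithin.
    case: dfwithP => // j kj.
    by have := xB j; rewrite /dprod_replace dfwithout.
  rewrite /dprod_replace/=.
  have [<-|ki] := eqVneq k i; first by rewrite dfwithin.
  by rewrite dfwithout//; have := xB i; rewrite dfwithout.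
have mB' i : measurable (dfwith B k setT i) by case: dfwithP.
transitivity (M (rectangle (dfwith B k setT)) * Q (B k))%E.
  by apply: product_measure1E => //; exact: measurable_rectangle.
rewrite nuM// (prE Q)// -EFinM; congr (_%:E).
rewrite (bigD1 k)//= [in RHS](bigD1 k)//= !dfwithin.
rewrite {1}/pr probability_setT/= mul1r mulrC; congr (_ * _).
by apply: eq_bigr => i ik; rewrite !dfwithout// eq_sym.
Qed.

(** Starting from the Dirac mass at the default point, the coordinates are overwritten one by one
    with fresh independent draws, each through a binary product measure. *)
Lemma product_law_ex nu : exists M : probability (dprod T) R, product_law nu M.
Proof.
pose nu' (s : seq I) i : probability (T i) R :=
  if i \in s then nu i else dirac point.
suff [M nuM] : exists M : probability (dprod T) R, product_law (nu' (enum I)) M.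
  exists M => B mB; rewrite nuM//; congr (_%:E); apply: eq_bigr => i _.
  by rewrite /nu' mem_enum.
elim: (enum I) => [|k s [M nuM]].
  exists (dirac ((fun i => point) : dprod T)) => B mB.
  rewrite /nu' /pr /= /dirac.
  rewrite indicE; have [h|h] := boolP (_ \in _).
    rewrite big1// => i _; rewrite indicE.
    by move: h; rewrite inE => /(_ i) h; rewrite mem_set.
  have [i hi] : exists i, ~ B i point.
    by apply/existsNP => hB; move: h; rewrite notin_setE; apply.
  by rewrite (bigD1 i)//= indicE memNset// mul0r.
exists (distribution (M \x nu k)%E (@dprod_replace k)) => B mB.
rewrite (@product_law_replace _ k M (nu k) nuM)//; congr (_%:E).
apply: eq_bigr => i _; congr (pr _ _).
have [<-|ki] := eqVneq k i; first by rewrite dfwithin /nu' mem_head.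
by rewrite dfwithout// /nu' inE eq_sym (negbTE ki).
Qed.

Definition prod_law nu : probability (dprod T) R := sval (cid (product_law_ex
  nu)).

Lemma prod_lawP nu : product_law nu (prod_law nu).
Proof. exact: svalP (cid (product_law_ex nu)). Qed.

Lemma pr_prod_law nu B : (forall i, measurable (B i)) ->
  pr (prod_law nu) (rectangle B) = \prod_i pr (nu i) (B i).
Proof. by move=> mB; rewrite {1}/pr prod_lawP. Qed.

(** The mixture of the two product laws exists as a law and factorizes on rectangles, as only the
    factor at [k] differs; uniqueness identifies it with the product law of [nu]. *)
Lemma prod_law_mixture p k nu nu0 nu1 :
  (forall i, i != k -> nu0 i = nu i) -> (forall i, i != k -> nu1 i = nu i) ->
  mixture p (nu0 k) (nu1 k) (nu k) ->
  mixture p (prod_law nu0) (prod_law nu1) (prod_law nu).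
Proof.
move=> nu0E nu1E [/andP[p0 p1] nuk]; split; first by rewrite p0.
have [|L LE] := @affine_law_ex _ _ _ (prod_law nu0) (prod_law nu1) p.
  move=> A mA; have /andP[h0 _] := pr_ge0_le1 (prod_law nu0) mA.
  have /andP[h1 _] := pr_ge0_le1 (prod_law nu1) mA.
  by rewrite addr_ge0// mulr_ge0// subr_ge0.
have nuL : product_law nu L.
  move=> B mB; apply: etrans (prE L (measurable_rectangle mB)) _.
  rewrite LE; last exact: measurable_rectangle.
  rewrite !pr_prod_law//; congr (_%:E).
  have prodE f : \prod_i pr (f i : probability (T i) R) (B i) =
    pr (f k) (B k) * \prod_(i | i != k) pr (f i) (B i) by rewrite (bigD1 k).
  rewrite (prodE nu) (prodE nu0) (prodE nu1) nuk// [RHS]mulrDl -!mulrA;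
    congr (_ * (_ * _) + _ * (_ * _)).
    by apply: eq_bigr => i ik; rewrite nu0E.
  by apply: eq_bigr => i ik; rewrite nu1E.
by move=> A mA; rewrite -LE// /pr (product_law_unique (prod_lawP nu) nuL).
Qed.

Lemma prod_law_pushforward nu nu' (s : dprod T -> dprod T) :
  measurable_fun setT s ->
  (forall B, (forall i, measurable (B i)) ->
     pr (prod_law nu) (s @^-1` rectangle B) = \prod_i pr (nu' i) (B i)) ->
  forall A, measurable A -> pr (prod_law nu) (s @^-1` A) = pr (prod_law nu') A.
Proof.
move=> ms nus A mA.
pose s' : {mfun dprod T >-> dprod T} :=
  HB.pack s (isMeasurableFun.Build _ _ _ _ s ms).
have nuM : product_law nu' (distribution (prod_law nu) s').
  by move=> B mB; rewrite -nus//; apply: prE; exact: measurable_rectangle.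
exact: (congr1 fine (product_law_unique nuM (prod_lawP nu') mA)).
Qed.

End product_law.

(** * The random sources of an execution *)

Lemma perm_measure_unique (R : realType) n (m1 m2 : {measure set 'S_n -> \bar
  R}) :
  (forall s, m1 [set s] = m2 [set s]) -> forall B, m1 B = m2 B.
Proof.
move=> m12 B.
have BE : B = \bigcup_(s in B) [set s] by rewrite bigcup_imset1 image_id.
have tI : trivIset B (fun s : 'S_n => [set s]).
  by move=> s t _ _ [x [/= -> ->]].
have fB : finite_set B by exact: finite_finset.
by rewrite BE !measure_fin_bigcup//; apply: eq_fsbigr => s _; exact: m12.
Qed.

Section sources.
Context (R : realType) (Pi : pic_protocol R).

Local Notation U := (user (group_size Pi)).
Local Notation source := (U + U + 'I_(num_groups Pi))%type.

Definition source_disp (k : source) : measure_display :=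
  match k with
  | inl (inl u) => @msg_disp R Pi (tag u)
  | inl (inr _) => key_disp Pi
  | inr _ => default_measure_display
  end.

Definition source_type (k : source) : measurableType (source_disp k) :=
  match k with
  | inl (inl u) => msg Pi (tag u)
  | inl (inr _) => key Pi
  | inr i => 'S_(group_size Pi i)
  end.

Local Notation D := (dprod source_type).

Definition source_law (sh : forall i, probability 'S_(group_size Pi i) R)
    (mu : forall u : U, probability (msg Pi (tag u)) R) (k : source) :
    probability (source_type k) R :=
  match k with
  | inl (inl u) => mu u
  | inl (inr _) => key_law Pi
  | inr i => sh i
  end.

Section execution_law.
Context (X : inputs Pi) (E : execution X).

Definition sources (w : sample E) : D := fun k =>
  match k with
  | inl (inl u) => sent E u w
  | inl (inr u) => pk E u w
  | inr i => shuffle E i w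
  end.

Lemma measurable_sources : measurable_fun setT sources.
Proof.
by apply: measurable_fun_dprod => -[[u|u]|i]; exact: measurable_funPT.
Qed.

HB.instance Definition _ := isMeasurableFun.Build _ _ _ _ sources
  measurable_sources.

(** Independence of the full family gives the product formula on rectangles. The uniform laws [sh]
    are a parameter so that executions on different inputs can share them. *)
Lemma execution_law (sh : forall i, probability 'S_(group_size Pi i) R) :
  (forall i s, sh i [set s] = (#|{: 'S_(group_size Pi i)}|%:R^-1)%:E) ->
  product_law (source_law sh (fun u => randomizer Pi (tag u) (X u)))
              (distribution (prob E) sources).
Proof.
move=> sh_unif B mB; rewrite /= /distribution /pushforward.
have := @sources_independent _ _ _ E [set: source]%SET
  (fun k => (fun w => sources w k) @^-1` B k).
have -> : \bigcap_(k in [set` [set: source]%SET]) (fun w => sources w k) @^-1` B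
  k
    = sources @^-1` rectangle B.
  by apply/seteqP; split=> [w wB k|w wB k _]; apply: wB => /=; rewrite ?inE.
move=> -> => [|k _]; last first.
  have {}mB := mB k; case: k mB => [[u|u]|i] mB.
  - by exists (B (inl (inl u))) => //; rewrite setTI.
  - by exists (B (inl (inr u))) => //; rewrite setTI.
  - by exists (B (inr i)) => //; rewrite setTI.
rewrite -prodEFin; apply: eq_big => [k|k _]; first by rewrite inE.
case: k => [[u|u]|i] /=.
- exact: (etrans (sent_law E (mB (inl (inl u)))) (prE _ (mB (inl (inl u))))).
- exact: (etrans (pk_law E u (mB (inl (inr u)))) (prE _ (mB (inl (inr u))))).
- apply: etrans (prE (sh i) (mB (inr i))).
  apply: (@perm_measure_unique _ _ (distribution (prob E) (shuffle E i)) (sh i))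
    => s.
  exact: (etrans (shuffle_law E s) (esym (sh_unif i s))).
Qed.

End execution_law.

Definition source_lists (x : D) : lists Pi := fun p =>
  let u := sender (fun i => x (inr i)) p in
  (x (inl (inr u)), x (inl (inl u))).

Definition source_server_view (C : {set party (group_size Pi)}) (x : D) :
    server_view Pi :=
  ((source_lists x, server_fun Pi (source_lists x)),
   corrupted_positions C (fun i => x (inr i))).

Definition source_users_view (C : {set party (group_size Pi)}) (x : D) :
    users_view C := fun u =>
  server_fun Pi (source_lists x) (position (fun i => x (inr i)) (val u)).

Lemma measurable_source_fiber i (s : 'S_(group_size Pi i)) :
  measurable ((fun x : D => x (inr i)) @^-1` [set s]).
Proof.
rewrite -[X in measurable X]setTI.
exact: (@measurable_dprod_coord _ _ source_type (inr i)).
Qed.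

Lemma measurable_source_lists : measurable_fun setT source_lists.
Proof.
apply: measurable_fun_dprod => -[i j].
pose g (s : 'S_(group_size Pi i)) (x : D) : (key Pi * msg Pi i)%type :=
  (x (inl (inr (mk_user (s j)))), x (inl (inl (mk_user (s j))))).
apply: (@measurable_fun_finite_choice _ _ _ _ _ (fun x : D => x (inr i)) g) =>
  s.
  exact: measurable_source_fiber.
apply/measurable_fun_pairP; split.
  exact: (@measurable_dprod_coord _ _ source_type (inl (inr _))).
exact: (@measurable_dprod_coord _ _ source_type (inl (inl (mk_user (s j))))).
Qed.

Lemma measurable_source_server_view C :
  measurable_fun setT (source_server_view C).
Proof.
apply/measurable_fun_pairP; split.
  apply/measurable_fun_pairP; split; first exact: measurable_source_lists.
  exact: measurableT_comp measurable_source_lists.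
apply: measurable_fun_dprod => i.
pose g (s : 'S_(group_size Pi i)) (x : D) : partial_perm (group_size Pi i) :=
  [ffun j => if mk_user j \in corrupted_users C
             then Some (s^-1%g j) else None].
apply: (@measurable_fun_finite_choice _ _ _ _ _ (fun x : D => x (inr i)) g) =>
  s.
  exact: measurable_source_fiber.
exact: measurable_cst.
Qed.

Lemma measurable_source_users_view C :
  measurable_fun setT (@source_users_view C).
Proof.
apply: measurable_fun_dprod => -[[i j] ijC].
pose g (s : 'S_(group_size Pi i)) (x : D) : out Pi i :=
  server_fun Pi (source_lists x) (mk_user (s^-1%g j)).
apply: (@measurable_fun_finite_choice _ _ _ _ _ (fun x : D => x (inr i)) g) =>
  s.
  exact: measurable_source_fiber.
pose T (p : U) := out Pi (tag p).
exact: (measurableT_comp (@measurable_dprod_coord _ _ T (mk_user (s^-1%g j)))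
  (measurableT_comp (measurable_funPT (server_fun Pi))
    measurable_source_lists)).
Qed.

(* Relabels the users by [t]; correcting the shuffles accordingly leaves the
   shuffled lists unchanged. *)
Definition relabel (t : forall i, 'S_(group_size Pi i)) (x : D) : D := fun k =>
  match k with
  | inl (inl u) => x (inl (inl (sender t u)))
  | inl (inr u) => x (inl (inr (sender t u)))
  | inr i => (x (inr i) * (t i)^-1)%g
  end.

Lemma measurable_relabel t : measurable_fun setT (relabel t).
Proof.
apply: measurable_fun_dprod => -[[u|u]|i] /=.
- exact: (@measurable_dprod_coord _ _ source_type (inl (inl (sender t u)))).
- exact: (@measurable_dprod_coord _ _ source_type (inl (inr (sender t u)))).
- pose g (s : 'S_(group_size Pi i)) : 'S_(group_size Pi i) := (s * (t i)^-1)%g.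
  have mg : measurable_fun setT g by [].
  exact: (measurableT_comp mg (@measurable_dprod_coord _ _ source_type (inr
    i))).
Qed.

Lemma source_lists_relabel t x : source_lists (relabel t x) = source_lists x.
Proof.
apply: functional_extensionality_dep => -[i j];
  rewrite /source_lists /= /sender /=.
by rewrite permM permKV.
Qed.

Definition fixes_corrupted (C : {set party (group_size Pi)})
    (t : forall i, 'S_(group_size Pi i)) : Prop :=
  forall u, u \in corrupted_users C -> t (tag u) (tagged u) = tagged u.

(** The inverse of s t^-1 is t s^-1, which agrees with s^-1 at every user fixed by t; so the
    positions of corrupted users do not move. *)
Lemma source_server_view_relabel C t x : fixes_corrupted C t ->
  source_server_view C (relabel t x) = source_server_view C x.
Proof.
move=> tC; rewrite /source_server_view source_lists_relabel; congr (_, _).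
apply: functional_extensionality_dep => i; apply/ffunP => j; rewrite !ffunE.
by case: ifPn => // /tC /= tj; rewrite invMg invgK permM tj.
Qed.

Lemma source_users_view_relabel C t x : fixes_corrupted C t ->
  @source_users_view C (relabel t x) = @source_users_view C x.
Proof.
move=> tC; apply: functional_extensionality_dep => -[[i j] ijC].
rewrite /source_users_view source_lists_relabel /=.
by rewrite /position /= invMg invgK permM (tC _ ijC).
Qed.

Section relabel_law.
Variables (sh : forall i, probability 'S_(group_size Pi i) R).
Hypothesis sh_unif :
  forall i s, sh i [set s] = (#|{: 'S_(group_size Pi i)}|%:R^-1)%:E.

Lemma uniform_perm_mulr i (s : 'S_(group_size Pi i)) B :
  pr (sh i) [set s' | B (s' * s)%g] = pr (sh i) B.
Proof.
pose g (s' : 'S_(group_size Pi i)) : 'S_(group_size Pi i) := (s' * s)%g.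
have mg : measurable_fun setT g by [].
pose g' : {mfun 'S_(group_size Pi i) >-> 'S_(group_size Pi i)} :=
  HB.pack g (isMeasurableFun.Build _ _ _ _ g mg).
apply: (congr1 fine).
apply: (@perm_measure_unique _ _ (distribution (sh i) g') (sh i)) => s'.
apply: (etrans _ (etrans (sh_unif (s' * s^-1)%g) (esym (sh_unif s')))).
rewrite /distribution /pushforward /=; congr (sh i _).
apply/seteqP; split=> [s'' /= <-|s'' /= ->]; first by rewrite /g mulgK.
by rewrite /g mulgKV.
Qed.

(** Relabelling sends rectangles to rectangles with permuted sides. The keys are identically
    distributed and the uniform shuffles are invariant under right translation, so only the message
    laws are permuted. *)
Lemma relabel_law t mu A : measurable A ->
  pr (prod_law (source_law sh mu)) (relabel t @^-1` A) =
  pr (prod_law (source_law sh (fun u => mu (sender t u)))) A.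
Proof.
apply: prod_law_pushforward; first exact: measurable_relabel.
move=> B mB.
pose tV i := ((t i)^-1)%g.
pose B' k : set (source_type k) :=
  match k with
  | inl (inl u) => B (inl (inl (sender tV u)))
  | inl (inr u) => B (inl (inr (sender tV u)))
  | inr i => [set s | B (inr i) (s * tV i)%g]
  end.
have -> : relabel t @^-1` rectangle B = rectangle B'.
  apply/seteqP; split=> x xB.
    move=> [[[i j]|[i j]]|i]; last exact: (xB (inr i)).
      have := xB (inl (inl (mk_user (tV i j)))).
      by rewrite /B' /relabel /sender /= permKV.
    have := xB (inl (inr (mk_user (tV i j)))).
    by rewrite /B' /relabel /sender /= permKV.
  move=> [[[i j]|[i j]]|i]; last exact: (xB (inr i)).
    have := xB (inl (inl (mk_user (t i j)))).
    by rewrite /B' /relabel /sender /= permK.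
  have := xB (inl (inr (mk_user (t i j)))).
  by rewrite /B' /relabel /sender /= permK.
have mB' k : measurable (B' k).
  by case: k => [[u|u]|i]; [exact: (mB (inl (inl _)))|exact: (mB (inl (inr
    _)))|].
rewrite pr_prod_law// !big_sumType/=.
have tK : cancel (sender tV) (sender t).
  by case=> i j; rewrite /sender /= permKV.
have tVK : cancel (sender t) (sender tV).
  by case=> i j; rewrite /sender /= permK.
congr (_ * _ * _).
- rewrite (reindex (sender t)); last by apply: onW_bij; exists (sender tV).
  by apply: eq_bigr => -[i j] _; rewrite /sender /= permK.
- rewrite (reindex (sender t)); last by apply: onW_bij; exists (sender tV).
  by apply: eq_bigr => -[i j] _; rewrite /sender /= permK.
- by apply: eq_bigr => i _; exact: uniform_perm_mulr.
Qed.

End relabel_law.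

End sources.

(** * Amplification by shuffling *)

Section group_laws.
Context (R : realType) (Pi : pic_protocol R) (C : {set party (group_size Pi)})
  (istar : 'I_(num_groups Pi)).

Local Notation U := (user (group_size Pi)).
Local Notation law i := (probability (msg Pi i) R).
Local Notation D := (dprod (@source_type R Pi)).

Variables (sh : forall i, probability 'S_(group_size Pi i) R)
  (base : forall i, 'I_(group_size Pi i) -> law i).
Hypothesis sh_unif :
  forall i s, sh i [set s] = (#|{: 'S_(group_size Pi i)}|%:R^-1)%:E.

(** Message spaces depend on the group, so [dfwith] overwrites the whole family of group [istar];
    within it the laws share one type, as the clone argument requires. *)
Definition group_laws (g : 'I_(group_size Pi istar) -> law istar) (u : U) :
    law (tag u) :=
  dfwith base istar g (tag u) (tagged u).

Lemma group_laws_in g j : group_laws g (mk_user j) = g j.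
Proof. by rewrite /group_laws /= dfwithin. Qed.

Lemma group_laws_out g i (j : 'I_(group_size Pi i)) : istar != i ->
  group_laws g (mk_user j) = base j.
Proof. by move=> ii; rewrite /group_laws /= dfwithout. Qed.

Variable A : set D.
Hypothesis mA : measurable A.
Hypothesis relabelA : forall t, fixes_corrupted C t -> relabel t @^-1` A = A.

Definition group_event g : R :=
  pr (prod_law (source_law sh (group_laws g))) A.

Lemma group_event_ge0_le1 g : 0 <= group_event g <= 1.
Proof. exact: pr_ge0_le1. Qed.

Lemma group_event_multiaffine :
  multiaffine (@mixture _ (msg Pi istar) R) group_event.
Proof.
move=> j p g g0 g1 g0E g1E mix.
have eq_off g' : (forall i, i != j -> g' i = g i) ->
    forall k, k != inl (inl (mk_user j)) ->
    source_law sh (group_laws g') k = source_law sh (group_laws g) k.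
  move=> g'E [[[i j']|u]|i] //= kj.
  have [ii|ii] := eqVneq istar i; last by rewrite !group_laws_out.
  case: _ / ii j' kj => j' kj; rewrite !group_laws_in g'E//.
  by apply: contraNneq kj => ->.
pose k : U + U + 'I_(num_groups Pi) := inl (inl (mk_user j)).
have mixk : mixture p (source_law sh (group_laws g0) k)
    (source_law sh (group_laws g1) k) (source_law sh (group_laws g) k).
  by rewrite /= !group_laws_in.
have [_ mixA] := prod_law_mixture (eq_off _ g0E) (eq_off _ g1E) mixk.
exact: mixA.
Qed.

(** The relabelling that swaps [x] and [y] in group [istar] and is trivial elsewhere moves only
    honest users, so it preserves [A] and acts on the laws alone. *)
Lemma group_event_tperm x y g :
  mk_user x \notin corrupted_users C -> mk_user y \notin corrupted_users C ->
  group_event (g \o tperm x y) = group_event g.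
Proof.
move=> xC yC.
pose t : forall i, 'S_(group_size Pi i) :=
  dfwith (fun i => 1%g : 'S_(group_size Pi i)) istar (tperm x y).
have tC : fixes_corrupted C t.
  case=> i j ijC /=; rewrite /t.
  have [ii|ii] := eqVneq istar i; last by rewrite dfwithout// perm1.
  case: _ / ii j ijC => j jC; rewrite dfwithin tpermD//.
    by apply: contraNneq xC => ->.
  by apply: contraNneq yC => ->.
rewrite /group_event -[in RHS](relabelA tC) relabel_law//.
congr (pr (prod_law (source_law sh _)) A).
apply: functional_extensionality_dep => -[i j].
have [ii|ii] := eqVneq istar i.
  case: _ / ii j => j; rewrite /sender /=.
  by rewrite !group_laws_in /t dfwithin.
by rewrite /sender /= !group_laws_out// /t dfwithout// perm1.
Qed.

End group_laws.

Lemma ldp_pr_le (R : realType) (eps : R) (I : Type) d (Z : measurableType d)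
    (K : I -> probability Z R) : ldp eps K ->
  forall x x' A, measurable A -> expR (- eps) * pr (K x) A <= pr (K x') A.
Proof.
move=> Kldp x x' A mA; have := @hockey_stick_ge _ _ _ eps (K x) (K x') A mA.
rewrite Kldp !prE// -EFinM -EFinB lee_fin subr_le0 => h.
by rewrite expRN mulrC ler_pdivrMr ?expR_gt0// mulrC.
Qed.

Section main_inequality.
Context (R : realType) (Pi : pic_protocol R) (C : {set party (group_size Pi)})
  (istar : 'I_(num_groups Pi)) (jstar : 'I_(group_size Pi istar))
  (eps delta : R) (X X' : inputs Pi) (E : execution X) (E' : execution X').
Let n' := #|(group_users (group_size Pi) istar :\: corrupted_users C)%SET|.
Hypothesis honest : mk_user jstar \notin corrupted_users C.
Hypothesis eps0 : 0 < eps.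
Hypothesis delta01 : 0 < delta <= 1.
Hypothesis ldpK : ldp eps (randomizer Pi istar).
Hypothesis n'_large : 16 * expR eps * ln (2 / delta) <= n'%:R.
Hypothesis XX' : forall u, u != mk_user jstar -> X u = X' u.

Local Notation D := (dprod (@source_type R Pi)).

Lemma other_honest_card :
  #|[set j | (j != jstar) && (mk_user j \notin corrupted_users C)]%SET|.+1 = n'.
Proof.
rewrite /n'; set O := finset _.
have -> : (group_users (group_size Pi) istar :\: corrupted_users C)%SET =
    (@mk_user _ _ istar @: (jstar |: O))%SET.
  apply/setP => -[i j]; apply/idP/imsetP => [|[j' j'O ->]].
    rewrite !inE /= => /andP[ijC /eqP ii].
    case: _ / (esym ii) j ijC => j jC; exists j => //.
    by rewrite !inE; case: eqP.
  move: j'O; rewrite !inE eqxx andbT.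
  by case: eqP => [->|_ /=] => [_|]; move: honest; rewrite inE.
rewrite card_imset; last first.
  by move=> j j' /eqP; rewrite eq_Tagged => /eqP.
by rewrite cardsU1 !inE eqxx.
Qed.

Lemma sources_event_le (A : set D) : measurable A ->
  (forall t, fixes_corrupted C t -> relabel t @^-1` A = A) ->
  (distribution (prob E) (@sources _ _ _ E) A <=
   (expR (shuffled_eps eps delta n'))%:E *
     distribution (prob E') (@sources _ _ _ E') A + delta%:E)%E.
Proof.
move=> mA relabelA.
pose K0 := randomizer Pi istar (X (mk_user jstar)).
pose K1 := randomizer Pi istar (X' (mk_user jstar)).
pose K j := randomizer Pi istar (X (mk_user j)).
set e := expR eps.
have e1 : 1 < e by rewrite expR_gt1.
have eN : expR (- eps) = e^-1 by rewrite expRN.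
have K01 B : measurable B -> pr K0 B <= e * pr K1 B.
  by move=> /(ldp_pr_le ldpK (X (mk_user jstar)) (X' (mk_user jstar)));
    rewrite eN ler_pdivrMl ?expR_gt0.
have K10 B : measurable B -> pr K1 B <= e * pr K0 B.
  by move=> /(ldp_pr_le ldpK (X' (mk_user jstar)) (X (mk_user jstar)));
    rewrite eN ler_pdivrMl ?expR_gt0.
have em1 : e - 1 != 0 by rewrite gt_eqF// subr_gt0.
have ep1 : e + 1 != 0 by rewrite gt_eqF//; lra.
have em0 : 0 < (e - 1)^-1 by rewrite invr_gt0 subr_gt0.
(* The law (e P - Q)/(e - 1), written as an affine combination; it is nonnegative exactly under the
   bound Q <= e P. *)
have ext (P Q : probability (msg Pi istar) R) :
    (forall B, measurable B -> pr Q B <= e * pr P B) ->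
    exists L : probability (msg Pi istar) R, forall B, measurable B ->
      pr L B = e / (e - 1) * pr P B + (1 - e / (e - 1)) * pr Q B.
  move=> PQ; apply: affine_law_ex => B mB.
  have -> : e / (e - 1) * pr P B + (1 - e / (e - 1)) * pr Q B =
      (e * pr P B - pr Q B) * (e - 1)^-1 by field.
  by rewrite mulr_ge0 ?subr_ge0 ?PQ// ltW.
have [Q0 Q0E] := ext _ _ K10.
have [Q1 Q1E] := ext _ _ K01.
have [H HE] : exists H : probability (msg Pi istar) R, forall B, measurable B ->
    pr H B = 2^-1 * pr Q0 B + (1 - 2^-1) * pr Q1 B.
  apply: affine_law_ex => B mB.
  have /andP[h0 _] := pr_ge0_le1 Q0 mB; have /andP[h1 _] := pr_ge0_le1 Q1 mB.
  by lra.
have HE' B : measurable B -> pr H B = 2^-1 * (pr K0 B + pr K1 B).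
  by move=> mB; rewrite HE// Q0E// Q1E//; field.
(* [H] is also the average of [K0] and [K1], so LDP bounds it by e times each [K j], which leaves a
   law [L j] once the clone part is removed. *)
have [|L LE] := @choice 'I_(group_size Pi istar) (probability (msg Pi istar) R)
    (fun j L => forall B, measurable B ->
      pr L B = e / (e - 1) * pr (K j) B + (1 - e / (e - 1)) * pr H B).
  move=> j; apply: ext => B mB; rewrite HE'//.
  have h x := ldp_pr_le ldpK x (X (mk_user j)) mB.
  have := h (X (mk_user jstar)); have := h (X' (mk_user jstar)).
  by rewrite eN !ler_pdivrMl ?expR_gt0// -/K0 -/K1 -/(K j) -/e; lra.
(* The shuffle laws of [E] also serve to describe [E'], so both probabilities are values of the same
   function [F]. *)
pose sh i : probability 'S_(group_size Pi i) R := distribution (prob E) (shuffle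
  E i).
have sh_unif i s : sh i [set s] = (#|{: 'S_(group_size Pi i)}|%:R^-1)%:E.
  exact: shuffle_law.
pose base i j := randomizer Pi i (X (mk_user j)).
pose F : ('I_(group_size Pi istar) -> probability (msg Pi istar) R) -> R :=
  group_event sh base A.
pose O := [set j | (j != jstar) && (mk_user j \notin corrupted_users C)]%SET.
have FX : distribution (prob E) (@sources _ _ _ E) A = (F (set_at jstar K
  K0))%:E.
  rewrite /F /group_event.
  have -> : group_laws base (set_at jstar K K0) =
      (fun u => randomizer Pi (tag u) (X u)).
    apply: functional_extensionality_dep => -[i j].
    have [ii|ii] := eqVneq istar i; last by rewrite group_laws_out.
    case: _ / ii j => j; rewrite group_laws_in /set_at.
    by case: eqP => [->|].
  rewrite -prE//.
  exact: (product_law_unique (execution_law E sh_unif) (prod_lawP _) mA).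
have FX' : distribution (prob E') (@sources _ _ _ E') A = (F (set_at jstar K
  K1))%:E.
  rewrite /F /group_event.
  have -> : group_laws base (set_at jstar K K1) =
      (fun u => randomizer Pi (tag u) (X' u)).
    apply: functional_extensionality_dep => -[i j].
    have [ii|ii] := eqVneq istar i; last first.
      rewrite group_laws_out// /base XX'//.
      by apply: contraNneq ii => /(congr1 tag) /= ->.
    case: _ / ii j => j; rewrite group_laws_in /set_at.
    case: eqP => [->//|/eqP jj]; rewrite /K XX'//.
    by rewrite eq_Tagged.
  rewrite -prE//.
  exact: (product_law_unique (execution_law E' sh_unif) (prod_lawP _) mA).
rewrite FX FX' -EFinM -EFinD lee_fin -other_honest_card.
apply: (@shuffled_mixture_le R _ _ (@mixture _ (msg Pi istar) R) F _ _
  O jstar _ _ eps delta Q0 Q1 H K0 K1 K L) => //.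
- exact: group_event_multiaffine.
- by move=> g; exact: group_event_ge0_le1.
- by rewrite !inE eqxx.
- move=> x g; rewrite inE => /andP[_ xC].
  exact: (group_event_tperm base sh_unif mA relabelA).
- by have -> : #|O|.+1 = n' by exact: other_honest_card.
- by split => //; lra.
- move=> j _; split; first by rewrite eN invr_ge0 invf_le1 ?expR_gt0//; lra.
  by move=> B mB; rewrite LE// eN; field; rewrite em1 gt_eqF//; lra.
- split; first by rewrite -/e divr_ge0 ?ler_pdivrMr//=; lra.
  by move=> B mB; rewrite Q0E// Q1E// -/e; field; rewrite em1.
- split; first by rewrite -/e divr_ge0 ?ler_pdivrMr//=; lra.
  by move=> B mB; rewrite Q0E// Q1E// -/e; field; rewrite em1.
Qed.

Lemma leakage_divergence_le :
  (leakage_divergence C (shuffled_eps eps delta n') E E' <= delta%:E)%E.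
Proof.
rewrite /leakage_divergence; case: ifPn => _; apply: hockey_stick_le => S mS.
(* The leakage is convertible to the source view composed with [sources], so its law at [S] is the
   law of the sources at the preimage of [S]. *)
- apply: (@sources_event_le (source_server_view C @^-1` S)).
    rewrite -[X in measurable X]setTI.
    exact: measurable_source_server_view.
  move=> t tC; apply/seteqP.
  by split=> x /=; rewrite source_server_view_relabel.
- apply: (@sources_event_le (@source_users_view _ _ C @^-1` S)).
    rewrite -[X in measurable X]setTI.
    exact: measurable_source_users_view.
  move=> t tC; apply/seteqP.
  by split=> x /=; rewrite source_users_view_relabel.
Qed.

End main_inequality.

Theorem theorem5p2 (R : realType) (Pi : pic_protocol R)
    (C : {set party (group_size Pi)})
    (istar : 'I_(num_groups Pi)) (jstar : 'I_(group_size Pi istar))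
    (eps delta : R)
    (X X' : inputs Pi) (E : execution X) (E' : execution X') :
  let ustar := mk_user jstar in
  let n' := #|group_users (group_size Pi) istar :\: corrupted_users C|%SET in
  let eps_c := shuffled_eps eps delta n' in
  ustar \notin corrupted_users C ->
  0 < eps -> 0 < delta <= 1 ->
  ldp eps (randomizer Pi istar) ->
  16 * expR eps * ln (2 / delta) <= n'%:R ->
  (forall u, u != ustar -> X u = X' u) ->
  (maxe (leakage_divergence C eps_c E E') (leakage_divergence C eps_c E' E)
    <= delta%:E)%E.
Proof.
move=> ustar n' eps_c honest eps0 delta01 ldpK n'_large XX'.
have X'X u : u != ustar -> X' u = X u by move=> /XX'.
rewrite ge_max; apply/andP; split.
  exact: leakage_divergence_le honest eps0 delta01 ldpK n'_large XX'.
exact: leakage_divergence_le honest eps0 delta01 ldpK n'_large X'X.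
Qed.
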